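(* Let $\mathcal{A}$ and $\mathcal{B}$ be Banach algebras. (i) Suppose that $\varphi:\mathcal{A}\to\mathcal{B}$ and $\psi:\mathcal{B}\to\mathcal{A}$ are continuous homomorphisms such that $\varphi\circ\psi=I_{\mathcal{B}}$. If $\mathcal{A}$ is approximately weakly amenable, then $\mathcal{B}$ is approximately weakly amenable. Moreover, if $(\mathcal{A}^{**},\square)$ is approximately weakly amenable, then $(\mathcal{B}^{**},\square)$ is approximately weakly amenable. (ii) Suppose that $\mathcal{A}$ is a dual Banach algebra. If $(\mathcal{A}^{**},\square)$ is approximately weakly amenable, then $\mathcal{A}$ is approximately weakly amenable. (iii) Suppose that $\mathcal{A}$ is commutative. Then $\mathcal{A}$ and $\mathcal{B}$ are (both) approximately weakly amenable if and only if the $\ell^1$-direct sum $\mathcal{A}\oplus_1\mathcal{B}$ is approximately weakly amenable. (iv) Suppose that $\mathcal{A}$ is weakly amenable. Then $\mathcal{B}$ is approximately weakly amenable if and only if the $\ell^1$-direct sum $\mathcal{A}\oplus_1\mathcal{B}$ is approximately weakly amenable. (v) Suppose that $\mathcal{A}$ is commutative. Then $\mathcal{A}$ is approximately weakly amenable if and only if $\mathcal{A}\widehat{\otimes}\mathcal{A}$ is approximately weakly amenable. (vi) Suppose that $\mathcal{A}$ and $\mathcal{B}$ are unital, and $\phi_1\in\Phi_{\mathcal{A}}$, $\phi_2\in\Phi_{\mathcal{B}}$. If $\mathcal{A}\widehat{\otimes}\mathcal{B}$ is approximately weakly amenable, then $\mathcal{A}$ and $\mathcal{B}$ are approximately weakly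 amenable.
   Context: For a Banach algebra $\mathcal{A}$, the dual $\mathcal{A}^*$ is a Banach $\mathcal{A}$-bimodule via $\langle a\cdot f,b\rangle=\langle f,ba\rangle$, $\langle f\cdot a,b\rangle=\langle f,ab\rangle$. $\square$ denotes the first Arens product on $\mathcal{A}^{**}$: if $(a_\alpha),(b_\beta)$ are nets in $\mathcal{A}$ converging weak-* to $a^{**},b^{**}$ in $\mathcal{A}^{**}$, then $a^{**}\square b^{**}=\omega^*\text{-}\lim_\alpha\lim_\beta a_\alpha b_\beta$; with it $\mathcal{A}^{**}$ is a Banach algebra. A derivation from a Banach algebra $\mathcal{C}$ into a Banach $\mathcal{C}$-bimodule $X$ is a bounded linear map $D$ with $D(ab)=D(a)\cdot b+a\cdot D(b)$. It is inner if there is $x\in X$ with $D(a)=a\cdot x-x\cdot a$ for all $a$, and approximately inner if there is a net $(x_i)$ in $X$ with $D(a)=\lim_i(a\cdot x_i-x_i\cdot a)$ in norm for every $a\in\mathcal{C}$. $\mathcal{C}$ is weakly amenable [resp. approximately weakly amenable] if every derivation $D:\mathcal{C}\to\mathcal{C}^*$ is inner [resp. approximately inner]. A Banach algebra $\mathcal{A}$ is dual if there is a closed submodule $\mathcal{A}_*$ of $\mathcal{A}^*$ such that $\mathcal{A}=(\mathcal{A}_* )^*$. A character on $\mathcal{A}$ is a non-zero homomorphism $\mathcal{A}\to\mathbb{C}$, and $\Phi_{\mathcal{A}}$ is the set of characters. $\widehat{\otimes}$ is the projective tensor product (with its usual Banach algebra structure); $\mathcal{A}\oplus_1\mathcal{B}$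 has coordinatewise product and norm $\|a\|+\|b\|$. *)

(* Defs.v *)
Set Warnings "-redundant-canonical-projection,-notation-overridden,-ambiguous-paths".
From HB Require Import structures.
From mathcomp Require Import all_boot all_order all_algebra ring lra.
From mathcomp Require Import complex.
From mathcomp Require Import all_classical reals topology normedtype sequences.

Set Implicit Arguments.
Unset Strict Implicit.
Unset Printing Implicit Defensive.

Import Order.TTheory GRing.Theory Num.Theory.
Import numFieldNormedType.Exports.

Local Open Scope classical_set_scope.
Local Open Scope ring_scope.
Local Open Scope complex_scope.

Section RealNorm.
Context {R : realType}.

(* In a normed module over R[i] the norm takes its values in R[i] (in its
   nonnegative reals); rnorm is the same norm with values in R. *)
Definition rnorm (V : normedModType R[i]) (x : V) : R := complex.Re `|x|.

Context {V : normedModType R[i]}.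
Implicit Types x y : V.

Lemma rnormE x : `|x| = (rnorm x)%:C.
Proof. by rewrite RRe_real// ger0_real. Qed.

Lemma rnorm_ge0 x : 0 <= rnorm x.
Proof. by rewrite -lecR -rnormE normr_ge0. Qed.

Lemma rnorm0_eq0 x : rnorm x = 0 -> x = 0.
Proof. by move=> x0; apply/normr0_eq0; rewrite rnormE x0. Qed.

Lemma rnorm0 : rnorm (0 : V) = 0.
Proof. by rewrite /rnorm normr0. Qed.

Lemma rnormN x : rnorm (- x) = rnorm x.
Proof. by rewrite /rnorm normrN. Qed.

Lemma rnormD x y : rnorm (x + y) <= rnorm x + rnorm y.
Proof. by rewrite -lecR rmorphD/= -!rnormE ler_normD. Qed.

Lemma rdistC x y : rnorm (x - y) = rnorm (y - x).
Proof. by rewrite /rnorm distrC. Qed.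

Lemma rnormcE (c : R[i]) : `|c| = (rnorm (c : R[i]^o))%:C.
Proof. by rewrite /rnorm RRe_real// ger0_real. Qed.

Lemma rnormZ (c : R[i]) x : rnorm (c *: x) = rnorm (c : R[i]^o) * rnorm x.
Proof.
by apply: (@complexI R); rewrite -rnormE normrZ rmorphM/= -rnormE -rnormcE.
Qed.

Lemma rnormV (c : R[i]) : rnorm (c^-1 : R[i]^o) = (rnorm (c : R[i]^o))^-1.
Proof. by apply: (@complexI R); rewrite fmorphV/= -!rnormcE normfV. Qed.

End RealNorm.

Section Completeness.
Context {R : realType}.

Definition rcauchy (T : normedModType R[i]) (u : nat -> T) := forall e : R, 0 < e ->
  exists N, forall m n, (N <= m)%N -> (N <= n)%N -> rnorm (u m - u n) < e.

Definition rlimit (T : normedModType R[i]) (u : nat -> T) (l : T) :=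
  forall e : R, 0 < e -> exists N, forall n, (N <= n)%N -> rnorm (u n - l) < e.

Lemma nbhs_rnormP (V : normedModType R[i]) (F : set_system V) (x : V) :
  Filter F -> (forall e : R, 0 < e -> F [set y | rnorm (x - y) < e]) -> F --> x.
Proof.
move=> FF H; apply/cvgrPdist_lt => e e0.
have er : e = (complex.Re e)%:C by rewrite RRe_real// gtr0_real.
move: e0; rewrite er ltcR => e0.
by apply: filterS (H _ e0) => y /=; rewrite rnormE ltcR.
Qed.

(* Completeness is stated in the library with filters; for normed spaces it is
   enough that Cauchy sequences converge. *)
Lemma seq_complete (V : normedModType R[i]) :
  (forall u : nat -> V, rcauchy u -> exists l, rlimit u l) ->
  forall F : set_system V, ProperFilter F -> cauchy F -> cvg F.
Proof.
move=> sc F FF /cauchy_ballP Fc.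
have H (n : nat) : exists A, F A /\ forall x y, A x -> A y -> rnorm (x - y) < n.+1%:R^-1.
  have e0 : 0 < (n.+1%:R^-1 : R)%:C by rewrite ltcR invr_gt0.
  have [[A B]/= [FA FB] AB] := Fc _ e0.
  exists (A `&` B); split; first exact: filterI.
  move=> x y [Ax _] [_ By]; have := AB (x, y) (conj Ax By).
  by rewrite /= -ball_normE/= rnormE ltcR.
have [A HA] := choice H.
pose B n := \bigcap_(i in [set i | (i < n.+1)%N]) A i.
have FB n : F (B n).
  elim: n => [|n ihn].
    by apply: filterS (HA 0%N).1 => x A0 i; rewrite /= ltnS leqn0 => /eqP ->.
  apply: filterS (filterI ihn (HA n.+1).1) => x [Bx Ax] i /=.
  by rewrite ltnS leq_eqVlt => /orP[/eqP ->//|]; exact: Bx.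
have [u Bu] := choice (fun n => filter_ex (FB n)).
have Au i n : (i <= n)%N -> A i (u n) by move=> le_in; apply: Bu.
have small (e : R) : 0 < e -> exists n, n.+1%:R^-1 < e.
  by move=> e0; exists (Num.truncn e^-1); rewrite invf_plt ?posrE// truncnS_gt.
have uc : rcauchy u.
  move=> e /small[N Ne]; exists N => m n Nm Nn.
  by apply: lt_trans Ne; apply: (HA N).2; exact: Au.
have [l ul] := sc u uc.
apply/cvg_ex; exists l; apply: nbhs_rnormP => e e0.
have e20 : 0 < e / 2 by rewrite divr_gt0.
have [N Ne] := small _ e20; have [M Me] := ul _ e20.
apply: filterS (HA N).1 => y Ay /=.
set k := maxn N M.
rewrite -(subrK (u k) l) -addrA (le_lt_trans (rnormD _ _))//.
rewrite [ltRHS]splitr ltrD//.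
  by rewrite rdistC Me// leq_maxr.
by apply: lt_trans Ne; apply: (HA N).2 => //; apply: Au; exact: leq_maxl.
Qed.

Lemma complex_seq_complete (u : nat -> R[i]^o) : rcauchy u -> exists l, rlimit u l.
Proof.
have ReE (z : R[i]^o) : `|complex.Re z| <= rnorm z.
  by rewrite -lecR -rnormE; exact: normc_ge_Re.
have ImE (z : R[i]^o) : `|complex.Im z| <= rnorm z.
  rewrite -lecR -rnormE normc_def lecR -sqrtr_sqr ler_sqrt ?addr_ge0 ?sqr_ge0//.
  by rewrite lerDr sqr_ge0.
have nE (z : R[i]^o) : rnorm z <= `|complex.Re z| + `|complex.Im z|.
  rewrite -lecR -rnormE; case: z {ReE ImE} => a b.
  rewrite [_ +i* _]complexE; apply: (le_trans (ler_normD _ _)) => /=.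
  rewrite normrM rmorphD/= !normc_def/= !expr0n !expr1n /= ?addr0 ?add0r sqrtr1 mul1r !sqrtr_sqr.
  by rewrite !(mul0r, mul1r, mulr0, subr0, addr0, add0r).
move=> uc.
have cv (f : R[i]^o -> R) : (forall z, `|f z| <= rnorm z) ->
    (forall x y, f (x - y) = f x - f y) ->
    exists l, forall e, 0 < e -> exists N, forall n, (N <= n)%N -> `|f (u n) - l| < e.
  move=> f_le fB.
  have : cvgn (f \o u).
    apply/cauchy_cvgP/cauchy_exP => e /uc[N Ne]; exists (f (u N)).
    exists N => // n /= Nn.
    by rewrite -ball_normE/= -fB (le_lt_trans (f_le _))// Ne.
  move=> /cvg_ex[l /cvgrPdist_lt fl]; exists l => e /fl[N _ Ne].
  by exists N => n Nn; rewrite distrC Ne.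
have [a ra] := cv _ ReE (fun x y => raddfB (@complex.Re R : Rcomplex R -> R) x y).
have [b ib] := cv _ ImE (fun x y => raddfB (@complex.Im R : Rcomplex R -> R) x y).
exists (a +i* b) => e e0.
have e20 : 0 < e / 2 by rewrite divr_gt0.
have [[N Ne] [M Me]] := (ra _ e20, ib _ e20).
exists (maxn N M) => n; rewrite geq_max => /andP[Nn Mn].
rewrite (le_lt_trans (nE _))// [ltRHS]splitr ltrD//.
  by move: (Ne _ Nn); case: (u n).
by move: (Me _ Mn); case: (u n).
Qed.

End Completeness.

Section Dual.
Context {R : realType} {V : normedModType R[i]}.

Definition bounded_functional : {pred V -> R[i]^o} := fun f =>
  `[< linear f /\ exists M : R, forall x, rnorm (f x) <= M * rnorm x >].

Lemma bounded_functionalP (f : V -> R[i]^o) :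
  reflect (linear f /\ exists M : R, forall x, rnorm (f x) <= M * rnorm x)
          (f \in bounded_functional).
Proof. exact: asboolP. Qed.

Lemma bounded_functional_submod : submod_closed bounded_functional.
Proof.
split.
  apply/bounded_functionalP; split; first by move=> c x y /=; rewrite scaler0 addr0.
  by exists 0 => x; rewrite mul0r rnorm0.
move=> c f g /bounded_functionalP[fl [M fM]] /bounded_functionalP[gl [N gN]].
apply/bounded_functionalP; split.
  move=> d x y /=; rewrite !fctE fl gl !scalerDr !scalerA addrACA.
  by rewrite [c * d]mulrC.
exists (rnorm (c : R[i]^o) * M + N) => x; rewrite (le_trans (rnormD _ _))// mulrDl.
apply: lerD => //; rewrite rnormZ -mulrA ler_wpM2l ?rnorm_ge0//.
Qed.

HB.instance Definition _ := GRing.isSubmodClosed.Build R[i] (V -> R[i]^o)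
  bounded_functional bounded_functional_submod.

End Dual.

Record dual (R : realType) (V : normedModType R[i]) := Dual {
  dual_fun :> V -> R[i]^o;
  dual_prop : dual_fun \in bounded_functional }.

HB.instance Definition _ (R : realType) (V : normedModType R[i]) :=
  [isSub for @dual_fun R V].
HB.instance Definition _ (R : realType) (V : normedModType R[i]) :=
  [Choice of dual V by <:].
HB.instance Definition _ (R : realType) (V : normedModType R[i]) :=
  [SubChoice_isSubLmodule of dual V by <:].

Section DualNorm.
Context {R : realType} {V : normedModType R[i]}.
Implicit Types (f g : dual V) (x : V).

Lemma dual_linear f : linear f.
Proof. by have /bounded_functionalP[] := dual_prop f. Qed.

HB.instance Definition _ f := GRing.isLinear.Build R[i] V R[i]^o _ f (dual_linear f).

Lemma dualP f g : (forall x, f x = g x) -> f = g.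
Proof. by move=> fg; apply/val_inj/funext. Qed.

Lemma dualDE f g x : (f + g) x = f x + g x. Proof. by []. Qed.
Lemma dualZE (c : R[i]) f x : (c *: f) x = c *: f x. Proof. by []. Qed.
Lemma dualNE f x : (- f) x = - f x. Proof. by []. Qed.
Lemma dual0E x : (0 : dual V) x = 0. Proof. by []. Qed.

(* The operator norm. *)
Definition dual_norm f : R :=
  inf [set M : R | 0 <= M /\ forall x, rnorm (f x) <= M * rnorm x].

Lemma dual_norm_has_inf f :
  has_inf [set M : R | 0 <= M /\ forall x, rnorm (f x) <= M * rnorm x].
Proof.
have /bounded_functionalP[_ [M fM]] := dual_prop f; split.
  exists `|M|; split => // x; apply: le_trans (fM x) _.
  by rewrite ler_wpM2r ?rnorm_ge0// ler_norm.
by exists 0 => M' [].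
Qed.

Lemma dual_norm_ge0 f : 0 <= dual_norm f.
Proof. by apply: lb_le_inf; [exact: (dual_norm_has_inf f).1|move=> M []]. Qed.

Lemma dual_norm_bound f x : rnorm (f x) <= dual_norm f * rnorm x.
Proof.
have [->|x0] := eqVneq x 0; first by rewrite linear0 !rnorm0 mulr0.
have xp : 0 < rnorm x.
  by rewrite lt0r rnorm_ge0 andbT; apply: contra_neq x0; exact: rnorm0_eq0.
rewrite -ler_pdivrMr//; apply: lb_le_inf; first exact: (dual_norm_has_inf f).1.
by move=> M [_ fM]; rewrite ler_pdivrMr.
Qed.

Lemma dual_norm_le f (M : R) : 0 <= M ->
  (forall x, rnorm (f x) <= M * rnorm x) -> dual_norm f <= M.
Proof. by move=> M0 fM; apply: ge_inf => //; exact: (dual_norm_has_inf f).2. Qed.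

Let dnorm f : R[i] := (dual_norm f)%:C.

Let dnormD f g : dnorm (f + g) <= dnorm f + dnorm g.
Proof.
rewrite /dnorm -rmorphD/= lecR; apply: dual_norm_le => [|x].
  by rewrite addr_ge0// dual_norm_ge0.
by rewrite dualDE (le_trans (rnormD _ _))// mulrDl lerD// dual_norm_bound.
Qed.

Let dnormZ_le (c : R[i]) f : dual_norm (c *: f) <= rnorm (c : R[i]^o) * dual_norm f.
Proof.
apply: dual_norm_le => [|x]; first by rewrite mulr_ge0 ?rnorm_ge0// dual_norm_ge0.
by rewrite dualZE rnormZ -mulrA ler_wpM2l ?rnorm_ge0// dual_norm_bound.
Qed.

Let dnormZ (c : R[i]) f : dnorm (c *: f) = `|c| * dnorm f.
Proof.
rewrite rnormcE /dnorm -rmorphM/=; congr (_%:C); apply/eqP; rewrite eq_le dnormZ_le/=.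
have [->|c0] := eqVneq c 0; first by rewrite rnorm0 mul0r dual_norm_ge0.
have cp : 0 < rnorm (c : R[i]^o) by rewrite -ltcR -rnormcE normr_gt0.
rewrite -ler_pdivlMl// -{1}[f](scalerK c0) (le_trans (dnormZ_le _ _))//.
by rewrite rnormV.
Qed.

Let dnorm0_eq0 f : dnorm f = 0 -> f = 0.
Proof.
move=> /complexI f0; apply: dualP => x; apply: rnorm0_eq0; apply/eqP.
by rewrite eq_le rnorm_ge0 andbT (le_trans (dual_norm_bound _ _))// f0 mul0r.
Qed.

HB.instance Definition _ :=
  Lmodule_isNormed.Build R[i] (dual V) dnormD dnormZ dnorm0_eq0.

Lemma rnorm_dualE f : rnorm f = dual_norm f. Proof. by []. Qed.

Lemma dual_seq_complete (u : nat -> dual V) : rcauchy u -> exists l, rlimit u l.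
Proof.
move=> uc.
have ux x : exists l : R[i]^o, rlimit (fun n => u n x) l.
  apply: complex_seq_complete => e e0.
  have x1 : 0 < rnorm x + 1 by rewrite ltr_wpDl// rnorm_ge0.
  have [N Ne] := uc (e / (rnorm x + 1)) (divr_gt0 e0 x1).
  exists N => m n Nm Nn; have := Ne m n Nm Nn; rewrite ltr_pdivlMr// => le_e.
  rewrite -[u m x - _]/((u m - u n) x) (le_lt_trans (dual_norm_bound _ _))//.
  by rewrite (le_lt_trans _ le_e)// ler_wpM2l ?dual_norm_ge0// lerDl ler01.
have [l ul] := choice ux.
have lim_le (a : nat -> R[i]^o) (b : R[i]^o) (M : R) : rlimit a b ->
    (exists N, forall n, (N <= n)%N -> rnorm (a n) <= M) -> rnorm b <= M.
  move=> ab [N aM]; apply/ler_addgt0Pr => e /ab[N' Ne].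
  rewrite -(subrK (a (maxn N N')) b) addrC (le_trans (rnormD _ _))// lerD//.
    by rewrite aM// leq_maxl.
  by rewrite rdistC ltW// Ne// leq_maxr.
have rlimD (a b : nat -> R[i]^o) (c d e : R[i]) : rlimit a c -> rlimit b d ->
    rlimit (fun n => e *: a n + b n) (e *: (c : R[i]^o) + d).
  move=> ac bd eps eps0.
  have e1 : 0 < rnorm (e : R[i]^o) + 1 by rewrite ltr_wpDl// rnorm_ge0.
  have p2 : 0 < eps / 2 by rewrite divr_gt0.
  have [[N Ne] [M Me]] := (ac _ (divr_gt0 p2 e1), bd _ p2).
  exists (maxn N M) => n; rewrite geq_max => /andP[/Ne Nn /Me Mn].
  rewrite opprD addrACA -scalerBr (le_lt_trans (rnormD _ _))//.
  rewrite [ltRHS]splitr ltr_leD ?(ltW Mn)//.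
  move: Nn; rewrite ltr_pdivlMr// => Nn; rewrite rnormZ (le_lt_trans _ Nn)//.
  by rewrite mulrC ler_wpM2l ?rnorm_ge0// lerDl.
have rlim_uniq (a : nat -> R[i]^o) (c d : R[i]^o) : rlimit a c -> rlimit a d -> c = d.
  move=> ac ad; apply/eqP; rewrite -subr_eq0; apply/eqP/rnorm0_eq0/eqP.
  rewrite eq_le rnorm_ge0 andbT; apply/ler_addgt0Pr => e e0; rewrite add0r.
  have p2 : 0 < e / 2 by rewrite divr_gt0.
  have [[N Ne] [M Me]] := (ac _ p2, ad _ p2).
  rewrite -(subrK (a (maxn N M)) c) -addrA (le_trans (rnormD _ _))//.
  rewrite [leRHS]splitr lerD//; first by rewrite rdistC ltW// Ne// leq_maxl.
  by rewrite ltW// Me// leq_maxr.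
have ll : linear l.
  move=> c x y; apply: rlim_uniq (ul (c *: x + y)) _.
  rewrite (_ : (fun n => _) = fun n => c *: u n x + u n y).
    by apply: rlimD.
  by apply/funext => n; rewrite linearP.
have unear (e : R) : 0 < e -> exists N, forall n, (N <= n)%N ->
    forall x, rnorm (u n x - l x) <= e * rnorm x.
  move=> /uc[N Ne]; exists N => n Nn x.
  apply: (lim_le (fun m => u n x - u m x)).
    move=> e' /(ul x)[N' Ne']; exists N' => m /Ne'.
    by rewrite (_ : u n x - u m x - _ = l x - u m x) 1?rdistC// opprB addrC addrA subrK.
  exists N => m Nm; rewrite -[u n x - _]/((u n - u m) x).
  rewrite (le_trans (dual_norm_bound _ _))// ler_wpM2r ?rnorm_ge0// ltW//.
  exact: Ne.
have lb : l \in bounded_functional.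
  apply/bounded_functionalP; split => //.
  have [N /(_ N (leqnn _)) Ne] := unear 1 ltr01.
  exists (1 + dual_norm (u N)) => x; rewrite -(subrK (u N x) (l x)).
  rewrite (le_trans (rnormD _ _))// mulrDl lerD//; first by rewrite rdistC.
  exact: dual_norm_bound.
exists (Dual lb) => e e0.
have p2 : 0 < e / 2 by rewrite divr_gt0.
have [N Ne] := unear _ p2; exists N => n /Ne un.
rewrite rnorm_dualE (@le_lt_trans _ _ (e / 2))//; last by rewrite gtr_pMr// invf_lt1// ltr1n.
by apply: dual_norm_le => [|x]; [exact: ltW|exact: un].
Qed.

HB.instance Definition _ :=
  Uniform_isComplete.Build (dual V) (seq_complete dual_seq_complete).

End DualNorm.

(* Complex Banach algebras, not assumed to be unital: the product is therefore
   not the product of a ring structure of the library. *)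
HB.mixin Record isBanachAlgebra (R : realType) A of CompleteNormedModule R[i] A := {
  bmul : A -> A -> A;
  bmulA : associative bmul;
  bmulDl : left_distributive bmul +%R;
  bmulDr : right_distributive bmul +%R;
  bmulZl : forall (c : R[i]) a b, bmul (c *: a) b = c *: bmul a b;
  bmulZr : forall (c : R[i]) a b, bmul a (c *: b) = c *: bmul a b;
  bnormM : forall a b, `|bmul a b| <= `|a| * `|b|
}.

#[short(type="banachAlgType")]
HB.structure Definition BanachAlgebra (R : realType) :=
  {A of isBanachAlgebra R A & CompleteNormedModule R[i] A}.

Notation "a ** b" := (bmul a b) (at level 40, left associativity) : ring_scope.

Section BanachAlgebraTheory.
Context {R : realType} {A : banachAlgType R}.
Implicit Types a b : A.

Lemma rnormM a b : rnorm (a ** b) <= rnorm a * rnorm b.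
Proof. by rewrite -lecR rmorphM/= -!rnormE bnormM. Qed.

Lemma bmul0l b : 0 ** b = 0.
Proof. by rewrite -(scale0r (0 : A)) bmulZl !scale0r. Qed.

Lemma bmul0r a : a ** 0 = 0.
Proof. by rewrite -(scale0r (0 : A)) bmulZr !scale0r. Qed.

Lemma bmulNl a b : (- a) ** b = - (a ** b).
Proof. by rewrite -scaleN1r bmulZl scaleN1r. Qed.

Lemma bmulNr a b : a ** (- b) = - (a ** b).
Proof. by rewrite -scaleN1r bmulZr scaleN1r. Qed.

Lemma bmulBl a b c : (a - b) ** c = a ** c - b ** c.
Proof. by rewrite bmulDl bmulNl. Qed.

Lemma bmulBr a b c : a ** (b - c) = a ** b - a ** c.
Proof. by rewrite bmulDr bmulNr. Qed.

End BanachAlgebraTheory.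

Section DualModule.
Context {R : realType} {A : banachAlgType R}.
Implicit Types (a b : A) (f : dual A).

Lemma dual_lact_subproof a f : (fun b => f (b ** a)) \in bounded_functional.
Proof.
apply/bounded_functionalP; split.
  by move=> c x y; rewrite bmulDl bmulZl linearP.
exists (dual_norm f * rnorm a) => x; rewrite (le_trans (dual_norm_bound _ _))//.
by rewrite -mulrA ler_wpM2l ?dual_norm_ge0// mulrC rnormM.
Qed.

Lemma dual_ract_subproof f a : (fun b => f (a ** b)) \in bounded_functional.
Proof.
apply/bounded_functionalP; split.
  by move=> c x y; rewrite bmulDr bmulZr linearP.
exists (dual_norm f * rnorm a) => x; rewrite (le_trans (dual_norm_bound _ _))//.
by rewrite -mulrA ler_wpM2l ?dual_norm_ge0// rnormM.
Qed.

(* <a . f, b> = <f, ba> and <f . a, b> = <f, ab>. *)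
Definition dual_lact a f : dual A := Dual (dual_lact_subproof a f).
Definition dual_ract f a : dual A := Dual (dual_ract_subproof f a).

Lemma dual_norm_ract f a : dual_norm (dual_ract f a) <= dual_norm f * rnorm a.
Proof.
apply: dual_norm_le => [|x]; first by rewrite mulr_ge0 ?dual_norm_ge0 ?rnorm_ge0.
rewrite (le_trans (dual_norm_bound f _))// -mulrA ler_wpM2l ?dual_norm_ge0//.
exact: rnormM.
Qed.

End DualModule.

Definition bidual (R : realType) (V : normedModType R[i]) := dual (dual V).

HB.instance Definition _ (R : realType) (V : normedModType R[i]) :=
  CompleteNormedModule.on (bidual V).

Section Arens.
Context {R : realType} {A : banachAlgType R}.
Implicit Types (a b : A) (f : dual A) (m n : bidual A).

Lemma bidual_act_subproof n f : (fun a => n (dual_ract f a)) \in bounded_functional.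
Proof.
apply/bounded_functionalP; split.
  move=> c x y; rewrite -linearP; congr (n _); apply: dualP => b.
  by rewrite dualDE dualZE/= bmulDl bmulZl linearP.
exists (dual_norm n * dual_norm f) => a; rewrite (le_trans (dual_norm_bound _ _))//.
by rewrite -mulrA ler_wpM2l ?dual_norm_ge0// dual_norm_ract.
Qed.

Definition bidual_act n f : dual A := Dual (bidual_act_subproof n f).

Lemma dual_norm_bidual_act n f : dual_norm (bidual_act n f) <= dual_norm n * dual_norm f.
Proof.
apply: dual_norm_le => [|a]; first by rewrite mulr_ge0 ?dual_norm_ge0.
rewrite (le_trans (dual_norm_bound n _))// -mulrA ler_wpM2l ?dual_norm_ge0//.
exact: dual_norm_ract.
Qed.

Lemma arens_subproof m n : (fun f => m (bidual_act n f)) \in bounded_functional.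
Proof.
apply/bounded_functionalP; split.
  move=> c f g; rewrite -linearP; congr (m _); apply: dualP => b.
  rewrite dualDE dualZE/= -linearP; congr (n _); exact: dualP.
exists (dual_norm m * dual_norm n) => f; rewrite (le_trans (dual_norm_bound _ _))//.
by rewrite -mulrA ler_wpM2l ?dual_norm_ge0// dual_norm_bidual_act.
Qed.

(* The first Arens product, <m [] n, f> = <m, n . f> where
   <n . f, a> = <n, f . a>.  It is the product given by the iterated weak-*
   limits lim_i lim_j a_i b_j over nets in A: see arens_iterated_limit, and
   bidual_weakstar_net for the existence of such nets. *)
Definition arens m n : bidual A := Dual (arens_subproof m n).

Lemma arensA : associative arens.
Proof.
move=> m n p; apply: dualP => f /=; congr (m _); apply: dualP => a /=.
congr (n _); apply: dualP => b /=; congr (p _); apply: dualP => c /=.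
by rewrite bmulA.
Qed.

Lemma arensDl : left_distributive arens +%R.
Proof. by move=> m n p; apply: dualP. Qed.

Lemma arensDr : right_distributive arens +%R.
Proof.
move=> m n p; apply: dualP => f; rewrite dualDE/= -linearD.
by congr (m _); apply: dualP.
Qed.

Lemma arensZl (c : R[i]) m n : arens (c *: m) n = c *: arens m n.
Proof. exact: dualP. Qed.

Lemma arensZr (c : R[i]) m n : arens m (c *: n) = c *: arens m n.
Proof.
apply: dualP => f; rewrite dualZE/= -linearZ; congr (m _); exact: dualP.
Qed.

Lemma arens_norm m n : `|arens m n| <= `|m| * `|n|.
Proof.
rewrite !rnormE -rmorphM/= lecR; apply: dual_norm_le => [|f].
  by rewrite mulr_ge0 ?rnorm_ge0.
rewrite (le_trans (dual_norm_bound m _))// -mulrA ler_wpM2l ?dual_norm_ge0//.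
exact: dual_norm_bidual_act.
Qed.

HB.instance Definition _ := isBanachAlgebra.Build R (bidual A)
  arensA arensDl arensDr arensZl arensZr arens_norm.

End Arens.

Section Nets.

Record directed (I : Type) (le : I -> I -> Prop) : Prop := Directed {
  directed_inhabited : inhabited I;
  directed_refl : forall i, le i i;
  directed_trans : forall i j k, le i j -> le j k -> le i k;
  directed_ub : forall i j, exists k, le i k /\ le j k }.

(* The filter of the sets that contain a tail of the directed set: a net x
   converges to l when x i @[i --> net_filter le] --> l. *)
Definition net_filter (I : Type) (le : I -> I -> Prop) : set_system I :=
  [set S | exists i, forall j, le i j -> S j].

Lemma net_filter_proper (I : Type) (le : I -> I -> Prop) :
  directed le -> ProperFilter (net_filter le).
Proof.
move=> [[i0] lexx le_trans le_ub].
split; first by move=> [i /(_ i (lexx i))].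
split; first by exists i0.
- move=> P Q [i iP] [j jQ]; have [k [ik jk]] := le_ub i j.
  by exists k => l kl; split; [apply: iP|apply: jQ]; exact: le_trans kl.
- by move=> P Q PQ [i iP]; exists i => j /iP /PQ.
Qed.

End Nets.

Section WeakStar.
Context {R : realType}.

Definition net_weakstar_cvg (V : normedModType R[i]) (I : Type) (le : I -> I -> Prop)
    (a : I -> V) (m : bidual V) :=
  forall f : dual V, f (a i) @[i --> net_filter le] --> m f.

Lemma arens_iterated_limit (A : banachAlgType R) (m n : bidual A)
    (I : Type) (leI : I -> I -> Prop) (a : I -> A)
    (J : Type) (leJ : J -> J -> Prop) (b : J -> A) :
  net_weakstar_cvg leI a m -> net_weakstar_cvg leJ b n ->
  forall f : dual A, exists2 c : I -> R[i]^o,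
    (forall i, f (a i ** b j) @[j --> net_filter leJ] --> c i) &
    c i @[i --> net_filter leI] --> (m ** n) f.
Proof.
move=> am bn f; exists (fun i => n (dual_ract f (a i))).
  by move=> i; exact: (bn (dual_ract f (a i))).
exact: (am (bidual_act n f)).
Qed.

Lemma bidual_interpolation (V : normedModType R[i]) (m : bidual V) (s : seq (dual V)) :
  exists a : V, forall f, f \in s -> f a = m f.
Proof.
have scaleE (c : R[i]) (x : R[i]^o) : c *: x = c * x :> R[i] by [].
have dep (t : seq (dual V)) (g : dual V) :
    (forall v, (forall f, f \in t -> f v = 0) -> g v = 0) ->
    forall a, (forall f, f \in t -> f a = m f) -> g a = m g.
  elim: t g => [|h t IH] g gt a ta.
    by rewrite (_ : g = 0) ?linear0//; apply: dualP => x; rewrite gt.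
  have [[v [tv hv]]|nv] := pselect (exists v, (forall f, f \in t -> f v = 0) /\ h v != 0).
    pose c : R[i] := g v / h v.
    have /IH -/(_ a) : forall w, (forall f, f \in t -> f w = 0) -> (g - c *: h) w = 0.
      move=> w tw; rewrite dualDE dualNE dualZE.
      have /eqP : g (w - (h w / h v) *: v) = 0.
        apply: gt => f; rewrite inE linearB linearZ/= => /orP[/eqP ->|ft].
          by rewrite scaleE divfK// subrr.
        by rewrite (tw _ ft) (tv _ ft) scaleE mulr0 subrr.
      rewrite linearB linearZ/= subr_eq0 => /eqP ->; apply/eqP; rewrite subr_eq0.
      by apply/eqP; rewrite !scaleE /c [LHS]mulrC [LHS]mulrA [LHS]mulrAC.
    move=> /(_ (fun f ft => ta f (mem_behead (s:=h::t) ft))).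
    have -> : m (g - c *: h) = m g - c *: m h by rewrite linearB linearZ.
    rewrite -(ta h) ?mem_head//.
    exact: addIr.
  apply: IH => [w tw|f ft]; last by apply: ta; rewrite inE ft orbT.
  apply: gt => f; rewrite inE => /orP[/eqP ->|]; last exact: tw.
  by apply: contrapT => /eqP hw; apply: nv; exists w.
elim: s => [|g s [a sa]]; first by exists 0.
have [[v [sv gv]]|nv] := pselect (exists v, (forall f, f \in s -> f v = 0) /\ g v != 0).
  exists (a + ((m g - g a) / g v) *: v) => f; rewrite inE linearD linearZ/=.
  move=> /orP[/eqP ->|fs]; last by rewrite (sv _ fs) scaleE mulr0 addr0 sa.
  by rewrite scaleE divfK// addrC subrK.
exists a => f; rewrite inE => /orP[/eqP ->|]; last exact: sa.
apply: dep sa => v sv; apply: contrapT => /eqP gv; apply: nv; by exists v.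
Qed.

Lemma bidual_weakstar_net (V : normedModType R[i]) (m : bidual V) :
  exists (I : Type) (le : I -> I -> Prop) (a : I -> V),
    directed le /\ net_weakstar_cvg le a m.
Proof.
have [a sa] := choice (bidual_interpolation m).
exists (seq (dual V)), (fun s t => {subset s <= t}), a; split.
  split => [|s|s t u st tu f /st /tu|s t]//; first by constructor; exact: [::].
  by exists (s ++ t); split => f fs; rewrite mem_cat fs ?orbT.
move=> f B /nbhs_singleton Bf; exists [:: f] => s sf.
by rewrite /= sa//; apply: sf; exact: mem_head.
Qed.

End WeakStar.

Section Derivations.
Context {R : realType} {A : banachAlgType R} {X : normedModType R[i]}.
Variables (lact : A -> X -> X) (ract : X -> A -> X).

Definition is_derivation (D : {linear A -> X}) : Prop :=
  (exists M : R[i], forall a, `|D a| <= M * `|a|) /\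
  forall a b, D (a ** b) = ract (D a) b + lact a (D b).

Definition is_inner (D : A -> X) : Prop :=
  exists x : X, forall a, D a = lact a x - ract x a.

Definition is_approx_inner (D : A -> X) : Prop :=
  exists (I : Type) (le : I -> I -> Prop) (x : I -> X), directed le /\
    forall a, lact a (x i) - ract (x i) a @[i --> net_filter le] --> D a.

End Derivations.

Definition weakly_amenable (R : realType) (A : banachAlgType R) : Prop :=
  forall D : {linear A -> dual A},
    is_derivation dual_lact dual_ract D -> is_inner dual_lact dual_ract D.

Definition approx_weakly_amenable (R : realType) (A : banachAlgType R) : Prop :=
  forall D : {linear A -> dual A},
    is_derivation dual_lact dual_ract D -> is_approx_inner dual_lact dual_ract D.

Record submod_of (R : realType) (V : normedModType R[i]) (S : submodClosed V) :=
  SubmodOf { submod_val :> V; submod_prop : submod_val \in S }.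

HB.instance Definition _ (R : realType) (V : normedModType R[i]) (S : submodClosed V) :=
  [isSub for @submod_val R V S].
HB.instance Definition _ (R : realType) (V : normedModType R[i]) (S : submodClosed V) :=
  [Choice of submod_of S by <:].
HB.instance Definition _ (R : realType) (V : normedModType R[i]) (S : submodClosed V) :=
  [SubChoice_isSubLmodule of submod_of S by <:].

Section SubmodNorm.
Context {R : realType} {V : normedModType R[i]} {S : submodClosed V}.
Implicit Types x y : submod_of S.

Let snorm x : R[i] := `|submod_val x|.
Let snormD x y : snorm (x + y) <= snorm x + snorm y.
Proof. exact: ler_normD. Qed.
Let snormZ (c : R[i]) x : snorm (c *: x) = `|c| * snorm x.
Proof. exact: normrZ. Qed.
Let snorm0_eq0 x : snorm x = 0 -> x = 0.
Proof. by move=> /normr0_eq0 x0; apply: val_inj. Qed.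

HB.instance Definition _ :=
  Lmodule_isNormed.Build R[i] (submod_of S) snormD snormZ snorm0_eq0.

End SubmodNorm.

Section DualBanachAlgebra.
Context {R : realType} {A : banachAlgType R}.

Lemma predual_eval_subproof (S : submodClosed (dual A)) (a : A) :
  (fun f : submod_of S => submod_val f a) \in bounded_functional.
Proof.
apply/bounded_functionalP; split => //.
by exists (rnorm a) => f; rewrite mulrC; exact: (dual_norm_bound (submod_val f) a).
Qed.

Definition predual_eval (S : submodClosed (dual A)) (a : A) : dual (submod_of S) :=
  Dual (predual_eval_subproof S a).

End DualBanachAlgebra.

(* A is the dual of the closed submodule S of its dual: the canonical map
   a |-> (f |-> f a) from A to the dual of S is an isometric bijection. *)
Definition dual_banach_algebra (R : realType) (A : banachAlgType R) : Prop :=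
  exists S : submodClosed (dual A),
    [/\ closed [set f | f \in S],
        forall (a : A) (f : dual A), f \in S -> dual_lact a f \in S /\ dual_ract f a \in S,
        forall a : A, `|predual_eval S a| = `|a| &
        forall g : dual (submod_of S), exists a : A, predual_eval S a = g].

(* An alias of the product type, whose own norm in the library is the max norm. *)
Definition l1sum (R : realType) (A B : banachAlgType R) : Type := (A * B)%type.

Section L1Sum.
Context {R : realType} {A B : banachAlgType R}.
Implicit Types x y z : l1sum A B.

HB.instance Definition _ := GRing.Lmodule.copy (l1sum A B) (A * B)%type.

Let norm1 x : R[i] := `|x.1| + `|x.2|.
Let norm1D x y : norm1 (x + y) <= norm1 x + norm1 y.
Proof. by rewrite /norm1 addrACA lerD// ler_normD. Qed.
Let norm1Z (c : R[i]) x : norm1 (c *: x) = `|c| * norm1 x.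
Proof. by rewrite /norm1 !normrZ mulrDr. Qed.
Let norm10_eq0 x : norm1 x = 0 -> x = 0.
Proof.
case: x => a b /eqP; rewrite /norm1 paddr_eq0 ?normr_ge0//= !normr_eq0.
by move=> /andP[/eqP -> /eqP ->].
Qed.

HB.instance Definition _ :=
  Lmodule_isNormed.Build R[i] (l1sum A B) norm1D norm1Z norm10_eq0.

Lemma l1sum_normE x : `|x| = `|x.1| + `|x.2|. Proof. by []. Qed.
Lemma l1sum_rnormE x : rnorm x = rnorm x.1 + rnorm x.2.
Proof. by apply: (@complexI R); rewrite rmorphD/= -!rnormE. Qed.

Lemma l1sum_seq_complete (u : nat -> l1sum A B) : rcauchy u -> exists l, rlimit u l.
Proof.
have cvgP (V : completeNormedModType R[i]) (v : nat -> V) : rcauchy v -> exists l, rlimit v l.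
  move=> vc; have : cvgn v.
    apply/cauchy_cvgP/cauchy_exP => e e0.
    have eE : e = (complex.Re e)%:C by rewrite RRe_real// gtr0_real.
    move: e0; rewrite eE ltcR => /vc[N Ne]; exists (v N).
    by exists N => // n /= Nn; rewrite -ball_normE/= rnormE ltcR Ne.
  move=> /cvg_ex[l /cvgrPdist_lt vl]; exists l => e e0.
  have [|N _ Ne] := vl e%:C; first by rewrite ltcR.
  by exists N => n /Ne; rewrite /= rnormE ltcR rdistC.
move=> uc.
have [|a ua] := cvgP _ (fun n => (u n).1).
  move=> e /uc[N Ne]; exists N => m n Nm Nn; have := Ne _ _ Nm Nn.
  by rewrite l1sum_rnormE; apply: le_lt_trans; rewrite lerDl rnorm_ge0.
have [|b ub] := cvgP _ (fun n => (u n).2).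
  move=> e /uc[N Ne]; exists N => m n Nm Nn; have := Ne _ _ Nm Nn.
  by rewrite l1sum_rnormE; apply: le_lt_trans; rewrite lerDr rnorm_ge0.
exists (a, b) => e e0; have e2 : 0 < e / 2 by rewrite divr_gt0.
have [[N Ne] [M Me]] := (ua _ e2, ub _ e2).
exists (maxn N M) => n; rewrite geq_max => /andP[Nn Mn].
by rewrite l1sum_rnormE [ltRHS]splitr ltrD// ?Ne ?Me.
Qed.

HB.instance Definition _ :=
  Uniform_isComplete.Build (l1sum A B) (seq_complete l1sum_seq_complete).

Let mul1 x y : l1sum A B := (x.1 ** y.1, x.2 ** y.2).
Let mul1A : associative mul1.
Proof. by move=> x y z; rewrite /mul1/= !bmulA. Qed.
Let mul1Dl : left_distributive mul1 +%R.
Proof. by move=> x y z; rewrite /mul1/= !bmulDl. Qed.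
Let mul1Dr : right_distributive mul1 +%R.
Proof. by move=> x y z; rewrite /mul1/= !bmulDr. Qed.
Let mul1Zl (c : R[i]) x y : mul1 (c *: x) y = c *: mul1 x y.
Proof. by rewrite /mul1/= !bmulZl. Qed.
Let mul1Zr (c : R[i]) x y : mul1 x (c *: y) = c *: mul1 x y.
Proof. by rewrite /mul1/= !bmulZr. Qed.
Let norm1M x y : `|mul1 x y| <= `|x| * `|y|.
Proof.
rewrite !l1sum_normE/= mulrDl lerD// (le_trans (bnormM _ _))//.
  by rewrite ler_wpM2l// lerDl.
by rewrite ler_wpM2l// lerDr.
Qed.

HB.instance Definition _ := isBanachAlgebra.Build R (l1sum A B)
  mul1A mul1Dl mul1Dr mul1Zl mul1Zr norm1M.

End L1Sum.

(* The completion of a seminormed algebra: the Cauchy sequences modulo the null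
   sequences, with the limit of the seminorms as norm. *)
Record seminormed_algebra (R : realType) := SeminormedAlgebra {
  sa_sort :> lmodType R[i];
  sa_norm : sa_sort -> R;
  sa_mul : sa_sort -> sa_sort -> sa_sort;
  sa_normD : forall x y, sa_norm (x + y) <= sa_norm x + sa_norm y;
  sa_normZ : forall (c : R[i]) x, sa_norm (c *: x) = rnorm (c : R[i]^o) * sa_norm x;
  sa_mulA : associative sa_mul;
  sa_mulDl : left_distributive sa_mul +%R;
  sa_mulDr : right_distributive sa_mul +%R;
  sa_mulZl : forall (c : R[i]) x y, sa_mul (c *: x) y = c *: sa_mul x y;
  sa_mulZr : forall (c : R[i]) x y, sa_mul x (c *: y) = c *: sa_mul x y;
  sa_normM : forall x y, sa_norm (sa_mul x y) <= sa_norm x * sa_norm y }.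

Arguments sa_norm {R s}.
Arguments sa_mul {R s}.

Section SeminormedAlgebraTheory.
Context {R : realType} {S : seminormed_algebra R}.
Implicit Types x y : S.

Lemma sa_norm0 : sa_norm (0 : S) = 0.
Proof. by rewrite -(scale0r (0 : S)) sa_normZ rnorm0 mul0r. Qed.

Lemma sa_normN x : sa_norm (- x) = sa_norm x.
Proof.
rewrite -scaleN1r sa_normZ rnormN (_ : rnorm _ = 1) ?mul1r//.
by apply: (@complexI R); rewrite -rnormcE normr1.
Qed.

Lemma sa_norm_ge0 x : 0 <= sa_norm x.
Proof.
have := sa_normD x (- x); rewrite subrr sa_norm0 sa_normN -mulr2n.
by rewrite pmulrn_lge0.
Qed.

Lemma sa_distC x y : sa_norm (x - y) = sa_norm (y - x).
Proof. by rewrite -sa_normN opprB. Qed.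

Lemma sa_dist_norm x y : `|sa_norm x - sa_norm y| <= sa_norm (x - y).
Proof.
have H u v : sa_norm u <= sa_norm v + sa_norm (u - v).
  by rewrite addrC -{1}(subrK v u) sa_normD.
by rewrite ler_norml lerBlDl H andbT lerNl opprB lerBlDl sa_distC H.
Qed.

Lemma sa_mulNl x y : sa_mul (- x) y = - sa_mul x y.
Proof. by rewrite -scaleN1r sa_mulZl scaleN1r. Qed.

Lemma sa_mulNr x y : sa_mul x (- y) = - sa_mul x y.
Proof. by rewrite -scaleN1r sa_mulZr scaleN1r. Qed.

Lemma sa_mulB x y x' y' :
  sa_mul x y - sa_mul x' y' = sa_mul (x - x') y + sa_mul x' (y - y').
Proof.
by rewrite sa_mulDl sa_mulDr sa_mulNl sa_mulNr addrA subrK.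
Qed.

Definition sa_cauchy : {pred nat -> S} := fun u => `[< forall e : R, 0 < e ->
  exists N, forall m n, (N <= m)%N -> (N <= n)%N -> sa_norm (u m - u n) < e >].

Lemma sa_cauchyP (u : nat -> S) :
  reflect (forall e : R, 0 < e -> exists N,
             forall m n, (N <= m)%N -> (N <= n)%N -> sa_norm (u m - u n) < e)
          (u \in sa_cauchy).
Proof. exact: asboolP. Qed.

Lemma sa_cauchy_submod : submod_closed sa_cauchy.
Proof.
split.
  by apply/sa_cauchyP => e e0; exists 0%N => m n _ _; rewrite subrr sa_norm0.
move=> c u v /sa_cauchyP uc /sa_cauchyP vc; apply/sa_cauchyP => e e0.
have c1 : 0 < rnorm (c : R[i]^o) + 1 by rewrite ltr_wpDl// rnorm_ge0.
have e2 : 0 < e / 2 by rewrite divr_gt0.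
have [[N Ne] [M Me]] := (uc _ (divr_gt0 e2 c1), vc _ e2).
exists (maxn N M) => m n; rewrite !geq_max => /andP[Nm Mm] /andP[Nn Mn].
rewrite !fctE opprD addrACA -scalerBr (le_lt_trans (sa_normD _ _))//.
rewrite [ltRHS]splitr ltr_leD ?(ltW (Me _ _ _ _))//.
have := Ne _ _ Nm Nn; rewrite ltr_pdivlMr// => lte; rewrite sa_normZ (le_lt_trans _ lte)//.
by rewrite mulrC ler_wpM2l ?sa_norm_ge0// lerDl ler01.
Qed.

HB.instance Definition _ := GRing.isSubmodClosed.Build R[i] (nat -> S)
  sa_cauchy sa_cauchy_submod.

End SeminormedAlgebraTheory.

Record cauchy_seq (R : realType) (S : seminormed_algebra R) := CauchySeq {
  cauchy_seq_fun :> nat -> S;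
  cauchy_seq_prop : cauchy_seq_fun \in sa_cauchy }.

HB.instance Definition _ (R : realType) (S : seminormed_algebra R) :=
  [isSub for @cauchy_seq_fun R S].
HB.instance Definition _ (R : realType) (S : seminormed_algebra R) :=
  [Choice of cauchy_seq S by <:].
HB.instance Definition _ (R : realType) (S : seminormed_algebra R) :=
  [SubChoice_isSubLmodule of cauchy_seq S by <:].

Section NullSeq.
Context {R : realType} {S : seminormed_algebra R}.

Definition null_seq : {pred cauchy_seq S} := fun u => `[< forall e : R, 0 < e ->
  exists N, forall n, (N <= n)%N -> sa_norm (u n) < e >].

Lemma null_seqP (u : cauchy_seq S) :
  reflect (forall e : R, 0 < e -> exists N, forall n, (N <= n)%N -> sa_norm (u n) < e)
          (u \in null_seq).
Proof. exact: asboolP. Qed.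

Lemma null_seq_zmod : zmod_closed null_seq.
Proof.
split.
  by apply/null_seqP => e e0; exists 0%N => n _; rewrite sa_norm0.
move=> u v /null_seqP u0 /null_seqP v0; apply/null_seqP => e e0.
have e2 : 0 < e / 2 by rewrite divr_gt0.
have [[N Ne] [M Me]] := (u0 _ e2, v0 _ e2).
exists (maxn N M) => n; rewrite geq_max => /andP[Nn Mn].
rewrite -[(u - v) n]/(u n - v n) (le_lt_trans (sa_normD _ _))// sa_normN.
by rewrite [ltRHS]splitr ltrD ?Ne ?Me.
Qed.

HB.instance Definition _ := GRing.isZmodClosed.Build (cauchy_seq S)
  null_seq null_seq_zmod.

Lemma null_seq_scale (c : R[i]) (u : cauchy_seq S) :
  u \in null_seq -> c *: u \in null_seq.
Proof.
move=> /null_seqP u0; apply/null_seqP => e e0.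
have c1 : 0 < rnorm (c : R[i]^o) + 1 by rewrite ltr_wpDl// rnorm_ge0.
have [N Ne] := u0 _ (divr_gt0 e0 c1); exists N => n /Ne.
rewrite ltr_pdivlMr// => lte; rewrite -[(c *: u) n]/(c *: u n) sa_normZ.
by rewrite (le_lt_trans _ lte)// mulrC ler_wpM2l ?sa_norm_ge0// lerDl ler01.
Qed.

Lemma cauchy_seq_bounded (u : cauchy_seq S) :
  exists M, 0 < M /\ exists N, forall n, (N <= n)%N -> sa_norm (u n) <= M.
Proof.
have /sa_cauchyP/(_ 1 ltr01)[N Ne] := cauchy_seq_prop u.
exists (1 + sa_norm (u N)); split; first by rewrite ltr_pwDl ?sa_norm_ge0.
exists N => n Nn; rewrite -{1}(subrK (u N) (u n)) (le_trans (sa_normD _ _))//.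
by rewrite lerD2r ltW// Ne.
Qed.

Lemma cauchy_seq_mul_subproof (u v : cauchy_seq S) :
  (fun n => sa_mul (u n) (v n)) \in sa_cauchy.
Proof.
have [[M [M0 [K uM]]] [L [L0 [J vL]]]] := (cauchy_seq_bounded u, cauchy_seq_bounded v).
have /sa_cauchyP uc := cauchy_seq_prop u; have /sa_cauchyP vc := cauchy_seq_prop v.
apply/sa_cauchyP => e e0; have e2 : 0 < e / 2 by rewrite divr_gt0.
have [[N Ne] [N' Ne']] := (uc _ (divr_gt0 e2 L0), vc _ (divr_gt0 e2 M0)).
exists (maxn (maxn K J) (maxn N N')) => m n; rewrite !geq_max.
move=> /andP[/andP[Km Jm] /andP[Nm N'm]] /andP[/andP[Kn Jn] /andP[Nn N'n]].
rewrite sa_mulB (le_lt_trans (sa_normD _ _))// [ltRHS]splitr ltrD//.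
  rewrite (le_lt_trans (sa_normM _ _))//.
  have := Ne _ _ Nm Nn; rewrite ltr_pdivlMr//; apply: le_lt_trans.
  by rewrite ler_wpM2l ?sa_norm_ge0// vL.
rewrite (le_lt_trans (sa_normM _ _))//.
have := Ne' _ _ N'm N'n; rewrite ltr_pdivlMr//; apply: le_lt_trans.
by rewrite mulrC ler_wpM2l ?sa_norm_ge0// uM.
Qed.

Definition cauchy_seq_mul (u v : cauchy_seq S) : cauchy_seq S :=
  CauchySeq (cauchy_seq_mul_subproof u v).

Lemma null_seq_mull (u v : cauchy_seq S) :
  u \in null_seq -> cauchy_seq_mul u v \in null_seq.
Proof.
move=> /null_seqP u0; have [L [L0 [J vL]]] := cauchy_seq_bounded v.
apply/null_seqP => e e0; have [N Ne] := u0 _ (divr_gt0 e0 L0).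
exists (maxn N J) => n; rewrite geq_max => /andP[/Ne]; rewrite ltr_pdivlMr// => lte Jn.
rewrite (le_lt_trans (sa_normM _ _))// (le_lt_trans _ lte)//.
by rewrite ler_wpM2l ?sa_norm_ge0// vL.
Qed.

Lemma null_seq_mulr (u v : cauchy_seq S) :
  v \in null_seq -> cauchy_seq_mul u v \in null_seq.
Proof.
move=> /null_seqP v0; have [L [L0 [J uL]]] := cauchy_seq_bounded u.
apply/null_seqP => e e0; have [N Ne] := v0 _ (divr_gt0 e0 L0).
exists (maxn N J) => n; rewrite geq_max => /andP[/Ne]; rewrite ltr_pdivlMr// => lte Jn.
rewrite (le_lt_trans (sa_normM _ _))// (le_lt_trans _ lte)// mulrC.
by rewrite ler_wpM2l ?sa_norm_ge0// uL.
Qed.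

End NullSeq.

Arguments null_seq {R} S.

Definition completion (R : realType) (S : seminormed_algebra R) :=
  Quotient.quot (null_seq S : zmodClosed (cauchy_seq S)).

HB.instance Definition _ (R : realType) (S : seminormed_algebra R) :=
  GRing.Zmodule.on (completion S).

Section Completion.
Context {R : realType} {S : seminormed_algebra R}.
Implicit Types (u v : cauchy_seq S) (p q : completion S).

Local Notation Q := (Quotient.quot (null_seq S : zmodClosed (cauchy_seq S))).

Definition completion_class u : completion S := \pi_Q%qT u.

Local Notation cls := completion_class.

Lemma completion_classP p : exists u, p = cls u.
Proof. by exists (repr (p : Q)); rewrite /completion_class reprK. Qed.

Lemma completion_class_eq u v : cls u = cls v <-> u - v \in null_seq S.
Proof.
by rewrite (Quotient.idealrBE (null_seq S : zmodClosed _)); split=> /eqP.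
Qed.

Lemma completion_classB u v : cls (u - v) = cls u - cls v.
Proof. exact: (raddfB (\pi_Q%qT)). Qed.

Lemma completion_classD u v : cls (u + v) = cls u + cls v.
Proof. exact: (raddfD (\pi_Q%qT)). Qed.

Lemma repr_class u : repr (cls u : Q) - u \in null_seq S.
Proof. by apply/completion_class_eq; rewrite /completion_class reprK. Qed.

Definition completion_scale (c : R[i]) p : completion S := cls (c *: repr (p : Q)).

Lemma completion_class_scale c u : cls (c *: u) = completion_scale c (cls u).
Proof.
apply/esym/completion_class_eq; rewrite -scalerBr; apply: null_seq_scale.
exact: repr_class.
Qed.

Let scaleA (c d : R[i]) p :
  completion_scale c (completion_scale d p) = completion_scale (c * d) p.
Proof.
have [u ->] := completion_classP p.
by rewrite -!completion_class_scale scalerA.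
Qed.
Let scale1 : left_id 1 completion_scale.
Proof.
by move=> p; have [u ->] := completion_classP p; rewrite -completion_class_scale scale1r.
Qed.
Let scaleDr : right_distributive completion_scale +%R.
Proof.
move=> c p q; have [u ->] := completion_classP p; have [v ->] := completion_classP q.
by rewrite -completion_classD -!completion_class_scale scalerDr completion_classD.
Qed.
Let scaleDl p : {morph completion_scale^~ p : c d / c + d}.
Proof.
move=> c d; have [u ->] := completion_classP p.
by rewrite -!completion_class_scale scalerDl completion_classD.
Qed.

HB.instance Definition _ := GRing.Zmodule_isLmodule.Build R[i] (completion S)
  scaleA scale1 scaleDr scaleDl.

Lemma completion_classZ (c : R[i]) u : cls (c *: u) = c *: cls u.
Proof. exact: completion_class_scale. Qed.

Definition completion_norm p : R := limn (fun n => sa_norm ((repr (p : Q) : cauchy_seq S) n)).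

Lemma completion_norm_class u : (fun n => sa_norm (u n)) @ \oo --> completion_norm (cls u).
Proof.
have norm_cvg v : cvgn (fun n => sa_norm (v n)).
  apply/cauchy_cvgP/cauchy_exP => e e0.
  have /sa_cauchyP/(_ e e0)[N Ne] := cauchy_seq_prop v.
  exists (sa_norm (v N)); exists N => // n /= Nn.
  by rewrite -ball_normE/= (le_lt_trans (sa_dist_norm _ _))// Ne.
have := norm_cvg (repr (cls u : Q)); rewrite /completion_norm.
set r := repr _; set l := limn _ => /= rl.
apply/cvgrPdist_lt => e e0; have e2 : 0 < e / 2 by rewrite divr_gt0.
move/cvgrPdist_lt : rl => /(_ _ e2)[N _ Ne].
have /null_seqP/(_ _ e2)[M Me] := repr_class u.
exists (maxn N M) => // n /=; rewrite geq_max => /andP[Nn Mn].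
rewrite -(subrK (sa_norm (r n)) l) -addrA (le_lt_trans (ler_normD _ _))//.
rewrite [ltRHS]splitr ltrD ?Ne// (le_lt_trans (sa_dist_norm _ _))//.
exact: Me.
Qed.

Arguments completion_norm_class u : clear implicits.

Let cnorm p : R[i] := (completion_norm p)%:C.

Let cnormD p q : cnorm (p + q) <= cnorm p + cnorm q.
Proof.
have [u ->] := completion_classP p; have [v ->] := completion_classP q.
rewrite /cnorm -rmorphD/= lecR -completion_classD.
have huv := cvgD (completion_norm_class u) (completion_norm_class v).
apply: (ler_cvg_to (completion_norm_class (u + v)) (huv _)).
by near=> n; exact: sa_normD.
Unshelve. all: by end_near. Qed.

Let cnormZ (c : R[i]) p : cnorm (c *: p) = `|c| * cnorm p.
Proof.
have [u ->] := completion_classP p.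
rewrite rnormcE /cnorm -rmorphM/= -completion_classZ; congr (_%:C).
have := @cvg_unique _ (@Rhausdorff R) _ _ _ _ (completion_norm_class (c *: u)); apply.
rewrite (_ : (fun n => _) = fun n => rnorm (c : R[i]^o) * sa_norm (u n)); last first.
  by apply/funext => n; rewrite -sa_normZ.
by apply: cvgMr; exact: completion_norm_class.
Qed.

Let cnorm0_eq0 p : cnorm p = 0 -> p = 0.
Proof.
have [u ->] := completion_classP p; move=> /complexI u0.
have -> : 0 = cls 0 by rewrite -(subrr (0 : cauchy_seq S)) completion_classB subrr.
apply/completion_class_eq; rewrite subr0; apply/null_seqP => e e0.
have /cvgrPdist_lt/(_ e e0)[N _ Ne] := completion_norm_class u.
exists N => n /Ne/=; rewrite u0 sub0r normrN; apply: le_lt_trans; exact: ler_norm.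
Qed.

HB.instance Definition _ :=
  Lmodule_isNormed.Build R[i] (completion S) cnormD cnormZ cnorm0_eq0.

Lemma completion_rnormE p : rnorm p = completion_norm p. Proof. by []. Qed.

Lemma completion_norm_le u (M : R) :
  (exists N, forall n, (N <= n)%N -> sa_norm (u n) <= M) -> rnorm (cls u) <= M.
Proof.
move=> [N uM]; apply: (cvgr_to_le (completion_norm_class u)).
by exists N => // n /= /uM.
Qed.

Lemma cst_cauchy (x : S) : (fun _ : nat => x) \in sa_cauchy.
Proof. by apply/sa_cauchyP => e e0; exists 0%N => m n _ _; rewrite subrr sa_norm0. Qed.

Definition completion_of (x : S) : completion S := cls (CauchySeq (cst_cauchy x)).

Lemma completion_of_norm x : rnorm (completion_of x) = sa_norm x.
Proof.
have := @cvg_unique _ (@Rhausdorff R) _ _ _ _ (completion_norm_class (CauchySeq (cst_cauchy x))); apply.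
exact: (cvg_cst (sa_norm x)).
Qed.

Lemma completion_of_linear : linear completion_of.
Proof.
move=> c x y; rewrite /completion_of -completion_classZ -completion_classD.
by congr (cls _); apply: val_inj.
Qed.

HB.instance Definition _ :=
  GRing.isLinear.Build R[i] S (completion S) _ completion_of completion_of_linear.

Lemma completion_of_dense p (e : R) : 0 < e -> exists x, rnorm (p - completion_of x) <= e.
Proof.
have [u ->] := completion_classP p => e0.
have /sa_cauchyP/(_ e e0)[N Ne] := cauchy_seq_prop u; exists (u N).
rewrite -completion_classB; apply: completion_norm_le; exists N => n Nn.
by apply/ltW/Ne.
Qed.

Lemma completion_seq_complete (w : nat -> completion S) :
  rcauchy w -> exists l, rlimit w l.
Proof.
move=> wc.
have small (e : R) : 0 < e -> exists n, n.+1%:R^-1 < e.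
  by move=> e0; exists (Num.truncn e^-1); rewrite invf_plt ?posrE// truncnS_gt.
have inv_gt0 n : 0 < n.+1%:R^-1 :> R by rewrite invr_gt0.
have [x wx] := choice (fun n => completion_of_dense (w n) (inv_gt0 n)).
have wx_lt (e : R) : 0 < e -> exists N, forall n, (N <= n)%N ->
    rnorm (w n - completion_of (x n)) < e.
  move=> /small[N Ne]; exists N => n Nn; rewrite (le_lt_trans (wx n))//.
  by rewrite (le_lt_trans _ Ne)// lef_pV2 ?posrE// ler_nat.
have xc : x \in sa_cauchy.
  apply/sa_cauchyP => e e0; have e3 : 0 < e / 3 by rewrite divr_gt0.
  have [[N Ne] [M Me]] := (wx_lt _ e3, wc _ e3).
  exists (maxn N M) => m n; rewrite !geq_max => /andP[Nm Mm] /andP[Nn Mn].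
  rewrite -completion_of_norm linearB/=.
  have -> : completion_of (x m) - completion_of (x n) =
    (completion_of (x m) - w m) + ((w m - w n) + (w n - completion_of (x n))).
    by rewrite !addrA subrK subrK.
  have -> : e = e / 3 + (e / 3 + e / 3) by field.
  rewrite (le_lt_trans (rnormD _ _))// ltrD//; first by rewrite rdistC Ne.
  by rewrite (le_lt_trans (rnormD _ _))// ltrD// ?Me ?Ne.
exists (cls (CauchySeq xc)) => e e0.
have e2 : 0 < e / 2 by rewrite divr_gt0.
have [N Ne] := wx_lt _ e2.
have /sa_cauchyP/(_ _ e2)[M Me] := xc.
exists (maxn N M) => n; rewrite geq_max => /andP[Nn Mn].
rewrite -(subrK (completion_of (x n)) (w n)) -addrA (le_lt_trans (rnormD _ _))//.
rewrite [ltRHS]splitr ltr_leD ?Ne// -completion_classB.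
apply: completion_norm_le; exists M => k Mk; by apply/ltW/Me.
Qed.

HB.instance Definition _ :=
  Uniform_isComplete.Build (completion S) (seq_complete completion_seq_complete).

Definition completion_mul p q : completion S :=
  cls (cauchy_seq_mul (repr (p : Q)) (repr (q : Q))).

Lemma completion_classM u v : cls (cauchy_seq_mul u v) = completion_mul (cls u) (cls v).
Proof.
apply/esym/completion_class_eq; set r := repr _; set s := repr _.
have -> : cauchy_seq_mul r s - cauchy_seq_mul u v =
    cauchy_seq_mul (r - u) s + cauchy_seq_mul u (s - v).
  by apply/val_inj/funext => n; exact: sa_mulB.
by apply: rpredD; [apply: null_seq_mull|apply: null_seq_mulr]; exact: repr_class.
Qed.

Let mulA : associative completion_mul.
Proof.
move=> p q r; have [u ->] := completion_classP p; have [v ->] := completion_classP q.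
have [w ->] := completion_classP r; rewrite -!completion_classM; congr (cls _).
by apply/val_inj/funext => n; exact: sa_mulA.
Qed.
Let mulDl : left_distributive completion_mul +%R.
Proof.
move=> p q r; have [u ->] := completion_classP p; have [v ->] := completion_classP q.
have [w ->] := completion_classP r.
rewrite -completion_classD -!completion_classM -completion_classD; congr (cls _).
by apply/val_inj/funext => n; exact: sa_mulDl.
Qed.
Let mulDr : right_distributive completion_mul +%R.
Proof.
move=> p q r; have [u ->] := completion_classP p; have [v ->] := completion_classP q.
have [w ->] := completion_classP r.
rewrite -completion_classD -!completion_classM -completion_classD; congr (cls _).
by apply/val_inj/funext => n; exact: sa_mulDr.
Qed.
Let mulZl (c : R[i]) p q : completion_mul (c *: p) q = c *: completion_mul p q.
Proof.
have [u ->] := completion_classP p; have [v ->] := completion_classP q.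
rewrite -completion_classZ -!completion_classM -completion_classZ; congr (cls _).
by apply/val_inj/funext => n; exact: sa_mulZl.
Qed.
Let mulZr (c : R[i]) p q : completion_mul p (c *: q) = c *: completion_mul p q.
Proof.
have [u ->] := completion_classP p; have [v ->] := completion_classP q.
rewrite -completion_classZ -!completion_classM -completion_classZ; congr (cls _).
by apply/val_inj/funext => n; exact: sa_mulZr.
Qed.
Let normM p q : `|completion_mul p q| <= `|p| * `|q|.
Proof.
have [u ->] := completion_classP p; have [v ->] := completion_classP q.
rewrite !rnormE -rmorphM/= lecR -completion_classM.
have huv := cvgM (completion_norm_class u) (completion_norm_class v).
apply: (ler_cvg_to (completion_norm_class (cauchy_seq_mul u v)) (huv _)).
by near=> n; exact: sa_normM.
Unshelve. all: by end_near. Qed.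

HB.instance Definition _ := isBanachAlgebra.Build R (completion S)
  mulA mulDl mulDr mulZl mulZr normM.

Lemma completion_ofM x y : completion_of (sa_mul x y) = completion_of x ** completion_of y.
Proof. by rewrite -[RHS]completion_classM; congr (cls _); apply: val_inj. Qed.

End Completion.

Record bilinear_form (R : realType) (A B : lmodType R[i]) := BilinearForm {
  bilinear_fun :> A -> B -> R[i]^o;
  bilinear_l : forall b, linear (bilinear_fun^~ b);
  bilinear_r : forall a, linear (bilinear_fun a) }.

(* The algebraic tensor product of A and B is realised as the space of the
   functionals Phi |-> \sum_i Phi a_i b_i on all (not only the bounded) bilinear
   forms on A x B; these separate the points of the tensor product. *)
Section AlgebraicTensor.
Context {R : realType} {A B : lmodType R[i]}.
Implicit Types (s : seq (A * B)) (Phi : bilinear_form A B).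

Definition tensor_sum s : bilinear_form A B -> R[i]^o :=
  fun Phi => \sum_(p <- s) Phi p.1 p.2.

Definition tensor_pred : {pred bilinear_form A B -> R[i]^o} :=
  fun u => `[< exists s, u = tensor_sum s >].

Lemma tensor_predP (u : bilinear_form A B -> R[i]^o) :
  reflect (exists s, u = tensor_sum s) (u \in tensor_pred).
Proof. exact: asboolP. Qed.

Lemma bilinearZl Phi (c : R[i]) a b : Phi (c *: a) b = c *: Phi a b.
Proof.
have lin := bilinear_l Phi b.
have P0 : Phi 0 b = 0.
  by apply: (addIr (Phi 0 b)); rewrite add0r -{1}[Phi 0 b]scale1r -lin scale1r addr0.
by rewrite -[c *: a]addr0 lin P0 addr0.
Qed.

Lemma bilinearZr Phi (c : R[i]) a b : Phi a (c *: b) = c *: Phi a b.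
Proof.
have lin := bilinear_r Phi a.
have P0 : Phi a 0 = 0.
  by apply: (addIr (Phi a 0)); rewrite add0r -{1}[Phi a 0]scale1r -lin scale1r addr0.
by rewrite -[c *: b]addr0 lin P0 addr0.
Qed.

Lemma bilinearDl Phi a a' b : Phi (a + a') b = Phi a b + Phi a' b.
Proof. by rewrite -[a]scale1r bilinear_l !scale1r. Qed.

Lemma bilinearDr Phi a b b' : Phi a (b + b') = Phi a b + Phi a b'.
Proof. by rewrite -[b]scale1r bilinear_r !scale1r. Qed.

Lemma tensor_sumZ (c : R[i]) s :
  c *: tensor_sum s = tensor_sum [seq (c *: p.1, p.2) | p <- s].
Proof.
apply/funext => Phi; rewrite !fctE /tensor_sum big_map scaler_sumr.
by apply: eq_bigr => p _; rewrite bilinearZl.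
Qed.

Lemma tensor_sumD s t : tensor_sum s + tensor_sum t = tensor_sum (s ++ t).
Proof. by apply/funext => Phi; rewrite !fctE /tensor_sum big_cat. Qed.

Lemma tensor_pred_submod : submod_closed tensor_pred.
Proof.
split.
  apply/tensor_predP; exists [::]; apply/funext => Phi.
  by rewrite /tensor_sum big_nil.
move=> c u v /tensor_predP[s ->] /tensor_predP[t ->]; apply/tensor_predP.
by eexists; rewrite tensor_sumZ tensor_sumD.
Qed.

HB.instance Definition _ := GRing.isSubmodClosed.Build R[i]
  (bilinear_form A B -> R[i]^o) tensor_pred tensor_pred_submod.

End AlgebraicTensor.

Record alg_tensor (R : realType) (A B : lmodType R[i]) := AlgTensor {
  alg_tensor_fun :> bilinear_form A B -> R[i]^o;
  alg_tensor_prop : alg_tensor_fun \in tensor_pred }.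

HB.instance Definition _ (R : realType) (A B : lmodType R[i]) :=
  [isSub for @alg_tensor_fun R A B].
HB.instance Definition _ (R : realType) (A B : lmodType R[i]) :=
  [Choice of alg_tensor A B by <:].
HB.instance Definition _ (R : realType) (A B : lmodType R[i]) :=
  [SubChoice_isSubLmodule of alg_tensor A B by <:].

Section ElementaryTensor.
Context {R : realType} {A B : lmodType R[i]}.

Lemma pure_tensor_subproof (a : A) (b : B) :
  (fun Phi : bilinear_form A B => Phi a b) \in tensor_pred.
Proof.
apply/tensor_predP; exists [:: (a, b)]; apply/funext => Phi.
by rewrite /tensor_sum big_seq1.
Qed.

Definition pure_tensor (a : A) (b : B) : alg_tensor A B :=
  AlgTensor (pure_tensor_subproof a b).

Lemma alg_tensorP (u v : alg_tensor A B) : (forall Phi, u Phi = v Phi) -> u = v.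
Proof. by move=> uv; apply/val_inj/funext. Qed.

Lemma sum_pure_tensorE (s : seq (A * B)) Phi :
  (\sum_(p <- s) pure_tensor p.1 p.2) Phi = tensor_sum s Phi.
Proof.
elim: s => [|p s ih]; first by rewrite /tensor_sum !big_nil.
by rewrite /tensor_sum !big_cons -[RHS]/(_ + tensor_sum s Phi) -ih.
Qed.

Lemma alg_tensor_span (u : alg_tensor A B) :
  exists s : seq (A * B), u = \sum_(p <- s) pure_tensor p.1 p.2.
Proof.
have /tensor_predP[s us] := alg_tensor_prop u; exists s.
by apply: alg_tensorP => Phi; rewrite sum_pure_tensorE us.
Qed.

Lemma pure_tensorDl a a' b : pure_tensor (a + a') b = pure_tensor a b + pure_tensor a' b.
Proof. by apply: alg_tensorP => Phi; exact: bilinearDl. Qed.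

Lemma pure_tensorDr a b b' : pure_tensor a (b + b') = pure_tensor a b + pure_tensor a b'.
Proof. by apply: alg_tensorP => Phi; exact: bilinearDr. Qed.

Lemma pure_tensorZl (c : R[i]) a b : pure_tensor (c *: a) b = c *: pure_tensor a b.
Proof. by apply: alg_tensorP => Phi; exact: bilinearZl. Qed.

Lemma pure_tensorZr (c : R[i]) a b : pure_tensor a (c *: b) = c *: pure_tensor a b.
Proof. by apply: alg_tensorP => Phi; exact: bilinearZr. Qed.

End ElementaryTensor.

Section TensorMul.
Context {R : realType} {A B : banachAlgType R}.
Implicit Types (u v w : alg_tensor A B) (Phi : bilinear_form A B).

Lemma alg_tensor_linear u (F : bilinear_form A B) (G : bilinear_form A B)
    (H : bilinear_form A B) (c : R[i]) :
  (forall a b, F a b = c *: G a b + H a b) -> u F = c *: u G + u H.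
Proof.
move=> FGH; have /tensor_predP[s ->] := alg_tensor_prop u.
rewrite /tensor_sum scaler_sumr -big_split/=.
by apply: eq_bigr => p _.
Qed.

Lemma alg_tensor_ext u (F G : bilinear_form A B) :
  (forall a b, F a b = G a b) -> u F = u G.
Proof.
move=> FG; have /tensor_predP[s ->] := alg_tensor_prop u.
by apply: eq_bigr => p _.
Qed.

(* The product u * v of two tensors is Phi |-> u (a, b |-> v (c, d |-> Phi (ac, bd))),
   so that (a (x) b) * (c (x) d) = ac (x) bd: see pure_tensorM. *)
Section Translate.
Variables (Phi : bilinear_form A B) (a : A) (b : B).
Let f (c : A) (d : B) : R[i]^o := Phi (a ** c) (b ** d).
Let fl d : linear (f^~ d).
Proof. by move=> k c c'; rewrite /f bmulDr bmulZr bilinear_l. Qed.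
Let fr c : linear (f c).
Proof. by move=> k d d'; rewrite /f bmulDr bmulZr bilinear_r. Qed.
Definition bilinear_translate : bilinear_form A B := BilinearForm fl fr.
End Translate.

Section Contract.
Variables (Phi : bilinear_form A B) (v : alg_tensor A B).
Let f (a : A) (b : B) : R[i]^o := v (bilinear_translate Phi a b).
Let fl b : linear (f^~ b).
Proof.
move=> k a a'; apply: alg_tensor_linear => c d /=.
by rewrite bmulDl bmulZl bilinear_l.
Qed.
Let fr a : linear (f a).
Proof.
move=> k b b'; apply: alg_tensor_linear => c d /=.
by rewrite bmulDl bmulZl bilinear_r.
Qed.
Definition bilinear_contract : bilinear_form A B := BilinearForm fl fr.
End Contract.

Definition seq_mul (s t : seq (A * B)) : seq (A * B) :=
  [seq (p.1 ** q.1, p.2 ** q.2) | p <- s, q <- t].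

Lemma alg_tensor_mulE u v s t :
  alg_tensor_fun u = tensor_sum s -> alg_tensor_fun v = tensor_sum t ->
  (fun Phi => u (bilinear_contract Phi v)) = tensor_sum (seq_mul s t).
Proof.
move=> us vt; apply/funext => Phi; rewrite us /tensor_sum /seq_mul.
rewrite big_allpairs_dep/=; apply: eq_bigr => p _.
by rewrite vt.
Qed.

Lemma alg_tensor_mul_subproof u v :
  (fun Phi => u (bilinear_contract Phi v)) \in tensor_pred.
Proof.
have /tensor_predP[s us] := alg_tensor_prop u.
have /tensor_predP[t vt] := alg_tensor_prop v.
by apply/tensor_predP; exists (seq_mul s t); exact: alg_tensor_mulE.
Qed.

Definition alg_tensor_mul u v : alg_tensor A B :=
  AlgTensor (alg_tensor_mul_subproof u v).

Lemma pure_tensorM a b c d :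
  alg_tensor_mul (pure_tensor a b) (pure_tensor c d) = pure_tensor (a ** c) (b ** d).
Proof. exact: alg_tensorP. Qed.

Let mulA : associative alg_tensor_mul.
Proof.
move=> u v w; apply: alg_tensorP => Phi /=; apply: alg_tensor_ext => a b /=.
apply: alg_tensor_ext => c d /=; apply: alg_tensor_ext => e f /=.
by rewrite !bmulA.
Qed.
Let mulDl : left_distributive alg_tensor_mul +%R.
Proof. by move=> u v w; apply: alg_tensorP. Qed.
Let mulZl (c : R[i]) u v : alg_tensor_mul (c *: u) v = c *: alg_tensor_mul u v.
Proof. exact: alg_tensorP. Qed.
Let mulr_lin (c : R[i]) u v w :
  alg_tensor_mul u (c *: v + w) = c *: alg_tensor_mul u v + alg_tensor_mul u w.
Proof.
apply: alg_tensorP => Phi; apply: (@alg_tensor_linear u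
  (bilinear_contract Phi (c *: v + w)) (bilinear_contract Phi v)
  (bilinear_contract Phi w) c).
by [].
Qed.
Let mulDr : right_distributive alg_tensor_mul +%R.
Proof. by move=> u v w; rewrite -[v]scale1r mulr_lin !scale1r. Qed.
Let mulr0 u : alg_tensor_mul u 0 = 0.
Proof. by apply: (addIr (alg_tensor_mul u 0)); rewrite -mulDr !add0r. Qed.
Let mulZr (c : R[i]) u v : alg_tensor_mul u (c *: v) = c *: alg_tensor_mul u v.
Proof. by rewrite -[c *: v]addr0 mulr_lin mulr0 addr0. Qed.

Definition cross_sum (s : seq (A * B)) : R := \sum_(p <- s) rnorm p.1 * rnorm p.2.

Definition proj_norm u : R :=
  inf [set cross_sum s | s in [set s | u = \sum_(p <- s) pure_tensor p.1 p.2]].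

Lemma cross_sum_ge0 s : 0 <= cross_sum s.
Proof. by apply: sumr_ge0 => p _; rewrite mulr_ge0 ?rnorm_ge0. Qed.

Lemma proj_norm_has_inf u :
  has_inf [set cross_sum s | s in [set s | u = \sum_(p <- s) pure_tensor p.1 p.2]].
Proof.
split; first by have [s us] := alg_tensor_span u; exists (cross_sum s); exists s.
by exists 0 => _ [s _ <-]; exact: cross_sum_ge0.
Qed.

Lemma proj_norm_le s : proj_norm (\sum_(p <- s) pure_tensor p.1 p.2) <= cross_sum s.
Proof. by apply: ge_inf; [exact: (proj_norm_has_inf _).2|exists s]. Qed.

Lemma proj_norm_ge0 u : 0 <= proj_norm u.
Proof.
apply: lb_le_inf; first exact: (proj_norm_has_inf u).1.
by move=> _ [s _ <-]; exact: cross_sum_ge0.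
Qed.

Lemma proj_norm_adherent u (e : R) : 0 < e ->
  exists2 s, u = \sum_(p <- s) pure_tensor p.1 p.2 & cross_sum s < proj_norm u + e.
Proof.
move=> e0; have [_ [s us <-] lt_s] := inf_adherent e0 (proj_norm_has_inf u).
by exists s.
Qed.

Let pnormD u v : proj_norm (u + v) <= proj_norm u + proj_norm v.
Proof.
apply/ler_addgt0Pr => e e0; have e2 : 0 < e / 2 by rewrite divr_gt0.
have [s us lts] := proj_norm_adherent u e2; have [t vt ltt] := proj_norm_adherent v e2.
rewrite {1}us {1}vt -big_cat (le_trans (proj_norm_le _))//.
rewrite /cross_sum big_cat/= [in leRHS](splitr e) addrACA.
by rewrite lerD// ltW.
Qed.

Let pnormZ_le (c : R[i]) u : proj_norm (c *: u) <= rnorm (c : R[i]^o) * proj_norm u.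
Proof.
apply/ler_addgt0Pr => e e0.
have c1 : 0 < rnorm (c : R[i]^o) + 1 by rewrite ltr_wpDl// rnorm_ge0.
have [s us lts] := proj_norm_adherent u (divr_gt0 e0 c1).
have -> : c *: u = \sum_(p <- [seq (c *: p.1, p.2) | p <- s]) pure_tensor p.1 p.2.
  rewrite us scaler_sumr big_map; apply: eq_bigr => p _.
  by rewrite pure_tensorZl.
rewrite (le_trans (proj_norm_le _))// /cross_sum big_map.
have -> : \sum_(p <- s) rnorm (c *: p.1, p.2).1 * rnorm (c *: p.1, p.2).2 =
    rnorm (c : R[i]^o) * cross_sum s.
  by rewrite /cross_sum mulr_sumr; apply: eq_bigr => p _; rewrite /= rnormZ mulrA.
have le1 : rnorm (c : R[i]^o) * cross_sum s <=
    rnorm (c : R[i]^o) * (proj_norm u + e / (rnorm (c : R[i]^o) + 1)).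
  by rewrite ler_wpM2l ?rnorm_ge0// ltW.
rewrite (le_trans le1)// mulrDr lerD2l mulrCA ler_piMr ?(ltW e0)//.
by rewrite ler_pdivrMr// mul1r lerDl ler01.
Qed.

Let pnormZ (c : R[i]) u : proj_norm (c *: u) = rnorm (c : R[i]^o) * proj_norm u.
Proof.
apply/eqP; rewrite eq_le pnormZ_le/=.
have [->|c0] := eqVneq c 0; first by rewrite rnorm0 mul0r proj_norm_ge0.
have cp : 0 < rnorm (c : R[i]^o) by rewrite -ltcR -rnormcE normr_gt0.
rewrite -ler_pdivlMl// -{1}[u](scalerK c0) (le_trans (pnormZ_le _ _))//.
by rewrite rnormV.
Qed.

Let pnormM u v : proj_norm (alg_tensor_mul u v) <= proj_norm u * proj_norm v.
Proof.
have le_eps (e : R) : 0 < e ->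
    proj_norm (alg_tensor_mul u v) <= (proj_norm u + e) * (proj_norm v + e).
  move=> e0.
  have [s us lts] := proj_norm_adherent u e0.
  have [t vt ltt] := proj_norm_adherent v e0.
  have -> : alg_tensor_mul u v = \sum_(p <- seq_mul s t) pure_tensor p.1 p.2.
    apply: alg_tensorP => Phi; rewrite sum_pure_tensorE -(@alg_tensor_mulE u v)//.
      by apply/funext => Psi; rewrite us sum_pure_tensorE.
    by apply/funext => Psi; rewrite vt sum_pure_tensorE.
  apply: (le_trans (proj_norm_le _)).
  apply: (@le_trans _ _ (cross_sum s * cross_sum t)); last first.
    by apply: ler_pM; rewrite ?cross_sum_ge0// ltW.
  rewrite /cross_sum /seq_mul big_allpairs_dep/= mulr_suml.
  apply: ler_sum => p _; rewrite mulr_sumr; apply: ler_sum => q _.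
  by rewrite mulrACA ler_pM ?rnorm_ge0// rnormM.
apply/ler_addgt0Pr => e e0.
pose K := proj_norm u + proj_norm v + 1.
have K0 : 0 < K by rewrite ltr_wpDl// addr_ge0 ?proj_norm_ge0.
pose d := Num.min 1 (e / K).
have d0 : 0 < d by rewrite lt_min ltr01 divr_gt0.
apply: (le_trans (le_eps d d0)).
have d1 : d <= 1 by rewrite ge_min lexx.
have dK : d * K <= e by rewrite -ler_pdivlMr// ge_min lexx orbT.
have := proj_norm_ge0 u; have := proj_norm_ge0 v; rewrite /K in dK.
nra.
Qed.

Definition tensor_algebra : seminormed_algebra R :=
  @SeminormedAlgebra R (alg_tensor A B) proj_norm alg_tensor_mul
    pnormD pnormZ mulA mulDl mulDr mulZl mulZr pnormM.

End TensorMul.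

Arguments tensor_algebra {R} A B.

Definition proj_tensor (R : realType) (A B : banachAlgType R) : Type :=
  completion (tensor_algebra A B).

HB.instance Definition _ (R : realType) (A B : banachAlgType R) :=
  BanachAlgebra.on (proj_tensor A B).

Section ProjTensorTheory.
Context {R : realType} {A B : banachAlgType R}.

Definition ptensor (a : A) (b : B) : proj_tensor A B :=
  completion_of (pure_tensor a b : tensor_algebra A B).

Lemma ptensorM a b c d : ptensor a b ** ptensor c d = ptensor (a ** c) (b ** d).
Proof. by rewrite /ptensor -pure_tensorM -completion_ofM. Qed.

Lemma ptensor_norm (s : seq (A * B)) :
  rnorm (\sum_(p <- s) ptensor p.1 p.2) = proj_norm (\sum_(p <- s) pure_tensor p.1 p.2).
Proof.
rewrite -[RHS](completion_of_norm (S := tensor_algebra A B)).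
by congr rnorm; exact/esym/(linear_sum (@completion_of _ (tensor_algebra A B))).
Qed.

Lemma ptensor_dense (p : proj_tensor A B) (e : R) : 0 < e ->
  exists s : seq (A * B), rnorm (p - \sum_(q <- s) ptensor q.1 q.2) <= e.
Proof.
move=> e0; have [x px] := completion_of_dense p e0.
have [s xs] := alg_tensor_span x; exists s.
by move: px; rewrite xs (linear_sum (@completion_of _ (tensor_algebra A B))).
Qed.

End ProjTensorTheory.

Section Vocabulary.
Context {R : realType}.

Definition algebra_hom (A B : banachAlgType R) (f : {linear A -> B}) : Prop :=
  forall a b, f (a ** b) = f a ** f b.

Definition commutative_algebra (A : banachAlgType R) : Prop :=
  forall a b : A, a ** b = b ** a.

Definition unital_algebra (A : banachAlgType R) : Prop :=
  exists e : A, forall a, e ** a = a /\ a ** e = a.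

Definition is_character (A : banachAlgType R) (phi : {linear A -> R[i]^o}) : Prop :=
  (forall a b, phi (a ** b) = phi a * phi b) /\ exists a, phi a <> 0.

End Vocabulary.

(* Main.v *)
Require Import Defs.
From HB Require Import structures.
From mathcomp Require Import all_boot all_order all_algebra lra ring.
From mathcomp Require Import complex.
From mathcomp Require Import all_classical reals topology normedtype sequences.

(** Everything rests on transporting derivations D : A -> A^* along
    homomorphisms.

    If psi : B -> A is a bounded homomorphism and every derivation of B is the
    restriction along psi of a derivation of A, then approximate weak amenability
    passes from A to B, because the functionals x_i that implement a
    derivation of A can be composed with psi ([approx_pullback]).  When psi has a left
    inverse homomorphism phi, the composition with phi provides the extension
    ([approx_retract]).  This gives (i), with phi and psi or with their second
    adjoints; it gives (ii), with the projection of the bidual of a dual Banach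
    algebra onto the algebra, which is the restriction of functionals to the predual
    ([predual_projection]); and it gives the passage from a direct sum to its
    summands in (iii) and (iv).  For (vi) one uses psi a = a (x) 1, with
    phi (a (x) b) = phi_2(b) a; characters are bounded by the Neumann series.

    The second ingredient is that an approximately weakly amenable algebra is
    essential: a bounded functional f that kills all products is zero, since
    otherwise a |-> f(a) f would be a derivation that is not approximately inner
    ([approx_essential]).  For a direct sum, this forces the mixed components of a
    derivation to vanish, and the two others can be approximated separately
    ([approx_l1sum]).

    For (v) the algebras are commutative, so inner derivations into the dual are
    zero and approximate weak amenability means that every derivation
    is zero.  A derivation D of a projective tensor product is encoded by the
    bounded 4-linear form T a b c d = D (a (x) b) (c (x) d), which satisfies the
    derivation identity on elementary tensors, and conversely every such form comes
    from a derivation ([tensor_derivation_lift]).  If all derivations of A are zero,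
    then so are those of the tensor square: the failure of T (a p) q w y = T p q (a w) y
    is itself a derivation in a ([tensor_derivation_shift]), and once a and b can be
    moved freely, one of the two terms on the right of the derivation identity equals
    the left-hand side, so that the other one vanishes
    ([commutative_tensor_zero_derivations]).  Conversely, a derivation of A pulls
    back along the multiplication a (x) b |-> ab, and the products are enough to
    detect it in an essential algebra ([zero_derivations_proj_tensor]). *)

Set Implicit Arguments.
Unset Strict Implicit.
Unset Printing Implicit Defensive.

Import Order.TTheory GRing.Theory Num.Theory.
Import numFieldNormedType.Exports.

Local Open Scope classical_set_scope.
Local Open Scope ring_scope.
Local Open Scope complex_scope.

(** * Bounded linear maps and adjoints *)

Section BoundedMaps.
Context {R : realType}.

(** Boundedness is a property of a bare function, rather than a structure, so that
    maps built by composition need no canonical instance.  For scalar targets it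
    unfolds to membership in the space of bounded functionals. *)
Definition bounded_map (V W : normedModType R[i]) (f : V -> W) : Prop :=
  linear f /\ exists M : R, forall x, rnorm (f x) <= M * rnorm x.

Section LinearMap.
Variables (V W : lmodType R[i]) (f : V -> W) (fl : linear f).

Definition linear_map of linear f := f.

HB.instance Definition _ :=
  GRing.isLinear.Build R[i] V W _ (linear_map fl) fl.

Definition linear_of : {linear V -> W} := linear_map fl.

End LinearMap.

Implicit Types U V W : normedModType R[i].

Lemma bounded_map_bound V W (f : V -> W) : bounded_map f ->
  exists2 M : R, 0 < M & forall x, rnorm (f x) <= M * rnorm x.
Proof.
move=> [_ [M fM]]; exists (`|M| + 1); first by rewrite ltr_wpDl.
move=> x; apply: le_trans (fM x) _; rewrite ler_wpM2r ?rnorm_ge0//.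
by rewrite (le_trans (ler_norm M))// lerDl.
Qed.

Lemma bounded_map_comp U V W (g : V -> W) (f : U -> V) :
  bounded_map g -> bounded_map f -> bounded_map (fun x => g (f x)).
Proof.
move=> bg bf; have [[gl _] [fl _]] := (bg, bf); split.
  by move=> c x y; rewrite fl gl.
have [[M M0 gM] [N N0 fN]] := (bounded_map_bound bg, bounded_map_bound bf).
exists (M * N) => x; rewrite (le_trans (gM _))// -mulrA ler_wpM2l//.
exact: ltW.
Qed.

Lemma bounded_mapB V W (f g : V -> W) :
  bounded_map f -> bounded_map g -> bounded_map (fun x => f x - g x).
Proof.
move=> [fl [M fM]] [gl [N gN]]; split.
  by move=> c x y; rewrite fl gl scalerBr addrACA opprD.
exists (M + N) => x; rewrite (le_trans (rnormD _ _))// rnormN mulrDl.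
exact: lerD.
Qed.

Lemma bounded_mapZl V (f : V -> R[i]^o) W (w : W) :
  bounded_map f -> bounded_map (fun x => (f x : R[i]) *: w).
Proof.
move=> [fl [M fM]]; split; first by move=> c x y; rewrite fl scalerDl scalerA.
exists (M * rnorm w) => x; rewrite rnormZ mulrAC ler_wpM2r ?rnorm_ge0//.
Qed.

Lemma bounded_map_dual V (f : dual V) : bounded_map f.
Proof. by have /bounded_functionalP := dual_prop f. Qed.

Lemma bounded_map_eval V (x : V) : bounded_map (fun f : dual V => f x).
Proof.
by split => //; exists (rnorm x) => f; rewrite mulrC; exact: dual_norm_bound.
Qed.

Definition dual_of V (f : V -> R[i]^o) (fb : bounded_map f) : dual V :=
  Dual (introT (bounded_functionalP f) fb).

Definition dual_map V W (f : V -> W) (fb : bounded_map f) (g : dual W) : dual V :=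
  dual_of (bounded_map_comp (bounded_map_dual g) fb).

Lemma dual_map_bounded V W (f : V -> W) (fb : bounded_map f) :
  bounded_map (dual_map fb).
Proof.
split; first by move=> c g h; apply: dualP.
have [M M0 fM] := bounded_map_bound fb; exists M => g.
apply: dual_norm_le => [|x]; first by rewrite mulr_ge0 ?(ltW M0) ?rnorm_ge0.
rewrite /= (le_trans (dual_norm_bound _ _))// [M * _]mulrC -mulrA.
by rewrite ler_wpM2l ?dual_norm_ge0.
Qed.

(** Continuity at 0 gives a ball of radius d that is mapped into the unit ball;
    every vector is rescaled to norm d / 2. *)
Lemma continuous_bounded_map V W (f : {linear V -> W}) :
  continuous f -> bounded_map f.
Proof.
move=> fc; split; first exact: linearP.
have /cvgrPdist_lt/(_ 1 ltr01) := fc 0.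
rewrite linear0 => /nbhs_ballP[e/= e0 ef].
have eE : e = (complex.Re e)%:C by rewrite RRe_real// gtr0_real.
move: e0 ef; rewrite eE ltcR; set d := complex.Re e => d0 ef.
exists (2 / d) => x.
have [->|x0] := eqVneq x 0; first by rewrite linear0 !rnorm0 mulr0.
have xp : 0 < rnorm x.
  by rewrite lt0r rnorm_ge0 andbT; apply: contra_neq x0; exact: rnorm0_eq0.
pose t : R := d / 2 / rnorm x.
have t0 : 0 < t by rewrite !divr_gt0.
have nt : rnorm (t%:C : R[i]^o) = t.
  by apply: (@complexI R); rewrite -rnormcE ger0_norm// lecR ltW.
have := ef (t%:C *: x); rewrite -ball_normE/= sub0r normrN rnormE ltcR rnormZ nt.
rewrite /t divfK ?gt_eqF// ltr_pdivrMr// ltr_pMr// ltr1n => /(_ isT).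
rewrite sub0r normrN rnormE ltcR linearZ/= rnormZ nt => lt1.
have -> : 2 / d * rnorm x = t^-1 by rewrite /t !invf_div mulrC.
by rewrite -[leRHS]mulr1 ler_pdivlMl// ltW.
Qed.

End BoundedMaps.

Section BoundedProduct.
Context {R : realType} {A : banachAlgType R}.

Lemma bounded_mulr (a : A) : bounded_map (fun x : A => x ** a).
Proof.
split; first by move=> c x y; rewrite bmulDl bmulZl.
by exists (rnorm a) => x; rewrite mulrC rnormM.
Qed.

Lemma bounded_mull (a : A) : bounded_map (fun x : A => a ** x).
Proof.
split; first by move=> c x y; rewrite bmulDr bmulZr.
by exists (rnorm a) => x; rewrite rnormM.
Qed.

End BoundedProduct.

(** * Derivations into the dual *)

Section DerivationForms.
Context {R : realType}.
Implicit Types A B : banachAlgType R.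

Lemma net_rnormP (V : normedModType R[i]) I (le : I -> I -> Prop) (u : I -> V) l :
  directed le ->
  (u i @[i --> net_filter le] --> l) <->
  (forall e : R, 0 < e -> exists i, forall j, le i j -> rnorm (u j - l) < e).
Proof.
move=> dle; have PF := net_filter_proper dle; split.
  move=> /cvgrPdist_lt ul e e0; have [|i iu] := ul e%:C; first by rewrite ltcR.
  by exists i => j /iu /=; rewrite rnormE ltcR rdistC.
move=> ul; apply: nbhs_rnormP => e e0; have [i iu] := ul e e0.
by exists i => j /iu /=; rewrite rdistC.
Qed.

(** The derivation identity tested on an element c of A; the two module actions
    have become multiplications of c, which is the form used in all computations. *)
Definition derivation A (D : A -> dual A) : Prop :=
  bounded_map D /\ forall a b c, D (a ** b) c = D a (b ** c) + D b (c ** a).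

Lemma is_derivationP A (D : {linear A -> dual A}) :
  is_derivation dual_lact dual_ract D <-> derivation D.
Proof.
split=> [[[M DM] Dm]|[[_ [M DM]] Dm]].
  split; last by move=> a b c; rewrite Dm.
  split; first exact: linearP.
  exists (complex.Re M) => a; have := DM a.
  rewrite !rnormE; case: (M) => x y; rewrite lecE/= => /andP[_].
  by rewrite mulr0 subr0.
split; last by move=> a b; apply: dualP => c; rewrite Dm.
by exists M%:C => a; rewrite !rnormE -rmorphM/= lecR.
Qed.

(** Norm convergence in the dual, as a bound that is uniform over the unit ball. *)
Lemma is_approx_innerP A (D : A -> dual A) :
  is_approx_inner dual_lact dual_ract D <->
  exists (I : Type) (le : I -> I -> Prop) (x : I -> dual A), directed le /\
    forall a (e : R), 0 < e -> exists i, forall j, le i j -> forall c,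
      rnorm (x j (c ** a) - x j (a ** c) - D a c) <= e * rnorm c.
Proof.
split=> -[I [le [x [dle xD]]]]; exists I, le, x; split=> // a.
  move=> e e0; have /(net_rnormP _ _ dle)/(_ e e0)[i ix] := xD a.
  exists i => j /ix ltx c.
  apply: le_trans (dual_norm_bound (dual_lact a (x j) - dual_ract (x j) a - D a) c) _.
  by rewrite ler_wpM2r ?rnorm_ge0// ltW.
apply/(net_rnormP _ _ dle) => e e0; have e2 : 0 < e / 2 by rewrite divr_gt0.
have [i ix] := xD a _ e2; exists i => j /ix xe.
apply: (@le_lt_trans _ _ (e / 2)); last by rewrite ltr_pdivrMr// ltr_pMr// ltr1n.
by apply: dual_norm_le; [exact: ltW|exact: xe].
Qed.

Lemma approx_weakly_amenableP A :
  approx_weakly_amenable A <->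
  forall D : A -> dual A, derivation D -> is_approx_inner dual_lact dual_ract D.
Proof.
split=> H D HD.
  have Dl := HD.1.1; apply: (H (linear_of Dl)).
  exact/is_derivationP.
by apply: H; exact/is_derivationP.
Qed.

End DerivationForms.

(** * Essential algebras and transfer along homomorphisms *)

Section Amenability.
Context {R : realType}.
Implicit Types A B : banachAlgType R.

Lemma rnorm_eps0 (V : normedModType R[i]) (M : R) (x : V) :
  (forall e : R, 0 < e -> rnorm x <= e * M) -> x = 0.
Proof.
move=> xM; apply: rnorm0_eq0; apply/eqP; rewrite eq_le rnorm_ge0 andbT.
apply/ler_addgt0Pr => e e0; rewrite add0r.
have M1 : 0 < `|M| + 1 by rewrite ltr_wpDl.
apply: le_trans (xM _ (divr_gt0 e0 M1)) _.
rewrite -mulrA ger_pMr// mulrC ler_pdivrMr// mul1r (le_trans (ler_norm _))//.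
by rewrite lerDl.
Qed.

(** By the Hahn-Banach theorem this says that the products span a dense
    subspace.  The form with functionals is the one that the arguments apply: each
    concludes that some functional vanishes because it kills the products. *)
Definition essential A : Prop := forall f : A -> R[i]^o, bounded_map f ->
  (forall a b, f (a ** b) = 0) -> forall a, f a = 0.

Definition zero_derivations A : Prop :=
  forall D : A -> dual A, derivation D -> forall a b, D a b = 0.

Lemma zero_derivations_approx A : zero_derivations A -> approx_weakly_amenable A.
Proof.
move=> A0; apply/approx_weakly_amenableP => D /A0 D0; apply/is_approx_innerP.
exists unit, (fun _ _ => True), (fun=> 0); split.
  by split => //; exists tt.
move=> a e e0; exists tt => _ _ c; rewrite D0 !dual0E !subr0 rnorm0.
by rewrite mulr_ge0 ?rnorm_ge0// ltW.
Qed.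

(** Over a commutative algebra every inner derivation into the dual is zero, hence
    so is a limit of such derivations. *)
Lemma approx_zero_derivations A : commutative_algebra A ->
  approx_weakly_amenable A -> zero_derivations A.
Proof.
move=> cA /approx_weakly_amenableP wA D /wA/is_approx_innerP.
move=> [I [le [x [[_ lexx _ _] xD]]]] a b; apply: (@rnorm_eps0 _ (rnorm b)) => e /(xD a)[i ix].
by have := ix i (lexx i) b; rewrite cA subrr sub0r rnormN.
Qed.

Lemma weakly_amenable_approx A : weakly_amenable A -> approx_weakly_amenable A.
Proof.
move=> wA; move=> D /wA[x xD]; apply/is_approx_innerP.
exists unit, (fun _ _ => True), (fun=> x); split.
  by split => //; exists tt.
move=> a e e0; exists tt => _ _ c; rewrite xD subrr rnorm0.
by rewrite mulr_ge0 ?rnorm_ge0// ltW.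
Qed.

(** If f kills the products, both sides of the derivation identity are zero. *)
Lemma rank_one_derivation A (f : A -> R[i]^o) (fb : bounded_map f) :
  (forall a b, f (a ** b) = 0) ->
  derivation (fun a => (f a : R[i]) *: dual_of fb).
Proof.
move=> f0; split; first exact: bounded_mapZl.
move=> a b c; rewrite !dualZE /= !f0 scale0r !scaler0.
by rewrite addr0.
Qed.

(** For a functional f that kills the products, D a = f(a) f is a derivation.  An
    inner derivation a . x - x . a takes the value x(aa) - x(aa) = 0 at a, so
    (D a) a = f(a) ^ 2 is a limit of zeros. *)
Lemma approx_essential A : approx_weakly_amenable A -> essential A.
Proof.
move=> /approx_weakly_amenableP wA f fb f0 a.
have /wA/is_approx_innerP[I [le [x [[_ lexx _ _] xD]]]] := rank_one_derivation fb f0.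
have /eqP : (f a : R[i]) *: f a = 0.
  apply: (@rnorm_eps0 _ (rnorm a)) => e /(xD a)[i ix].
  by have := ix i (lexx i) a; rewrite subrr sub0r rnormN.
by rewrite scaler_eq0 orbb => /eqP.
Qed.

Lemma zero_derivations_essential A : zero_derivations A -> essential A.
Proof. by move=> /zero_derivations_approx/approx_essential. Qed.

Lemma derivation_restrict A B (psi : B -> A) (psib : bounded_map psi)
    (D : A -> dual A) :
  (forall a b, psi (a ** b) = psi a ** psi b) -> derivation D ->
  derivation (fun a => dual_map psib (D (psi a))).
Proof.
move=> psiM [Db Dm]; split; last by move=> a b c; rewrite /= !psiM Dm.
exact: bounded_map_comp (dual_map_bounded psib) (bounded_map_comp Db psib).
Qed.

(** If E is the limit of the inner derivations given by functionals x_i on A, then D is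
    the limit of those given by the x_i composed with psi. *)
Lemma approx_pullback A B (psi : B -> A) :
  bounded_map psi -> (forall a b, psi (a ** b) = psi a ** psi b) ->
  (forall D : B -> dual B, derivation D -> exists2 E : A -> dual A,
     derivation E & forall a b, E (psi a) (psi b) = D a b) ->
  approx_weakly_amenable A -> approx_weakly_amenable B.
Proof.
move=> pb pM lift /approx_weakly_amenableP wA; apply/approx_weakly_amenableP => D.
move=> /lift[E /wA/is_approx_innerP[I [le [x [dle xE]]]] ED]; apply/is_approx_innerP.
exists I, le, (fun i => dual_map pb (x i)).
split=> // a e e0; have [M M0 pM'] := bounded_map_bound pb.
have [i ix] := xE (psi a) _ (divr_gt0 e0 M0); exists i => j /ix xj c.
rewrite /= !pM -ED (le_trans (xj _))// mulrAC ler_pdivrMr// -mulrA.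
by rewrite ler_wpM2l ?(ltW e0)// mulrC.
Qed.

(** A derivation D of B lifts to the derivation D (phi a) (phi a') of A, because
    phi is a homomorphism; it restricts to D along psi because phi psi = id. *)
Lemma approx_retract A B (phi : A -> B) (psi : B -> A) :
  bounded_map phi -> (forall a b, phi (a ** b) = phi a ** phi b) ->
  bounded_map psi -> (forall a b, psi (a ** b) = psi a ** psi b) ->
  (forall b, phi (psi b) = b) ->
  approx_weakly_amenable A -> approx_weakly_amenable B.
Proof.
move=> phib phiM psib psiM phiK; apply: (approx_pullback psib psiM) => D dD.
exists (fun a => dual_map phib (D (phi a))) => [|a b]; last by rewrite /= !phiK.
exact: derivation_restrict.
Qed.

Definition bidual_map A B (phi : A -> B) (phib : bounded_map phi) :
  bidual A -> bidual B := dual_map (dual_map_bounded phib).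

Lemma bidual_mapM A B (phi : A -> B) (phib : bounded_map phi) :
  (forall a b, phi (a ** b) = phi a ** phi b) ->
  forall m n : bidual A, bidual_map phib (m ** n) = bidual_map phib m ** bidual_map phib n.
Proof.
move=> phiM m n; apply: dualP => g /=; congr (m _); apply: dualP => a /=.
by congr (n _); apply: dualP => b /=; rewrite phiM.
Qed.

Lemma approx_retract_bidual A B (phi : A -> B) (psi : B -> A) :
  bounded_map phi -> (forall a b, phi (a ** b) = phi a ** phi b) ->
  bounded_map psi -> (forall a b, psi (a ** b) = psi a ** psi b) ->
  (forall b, phi (psi b) = b) ->
  approx_weakly_amenable (bidual A) -> approx_weakly_amenable (bidual B).
Proof.
move=> phib phiM psib psiM phiK.
apply: (@approx_retract (bidual A) (bidual B) (bidual_map phib) (bidual_map psib)).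
- exact: dual_map_bounded.
- exact: bidual_mapM.
- exact: dual_map_bounded.
- exact: bidual_mapM.
move=> m; apply: dualP => g /=; congr (m _); apply: dualP => b /=.
by rewrite phiK.
Qed.

End Amenability.

(** * Dual Banach algebras *)

Section Bidual.
Context {R : realType}.
Implicit Types A B : banachAlgType R.

Definition canonical_embedding A (a : A) : bidual A := dual_of (bounded_map_eval a).

Lemma canonical_embedding_bounded A : bounded_map (@canonical_embedding A).
Proof.
split; first by move=> c x y; apply: dualP => f; rewrite /= linearP.
exists 1 => x; rewrite mul1r; apply: dual_norm_le => [|f]; first exact: rnorm_ge0.
rewrite [leRHS]mulrC; exact: (dual_norm_bound f x).
Qed.

Lemma canonical_embeddingM A (a b : A) :
  canonical_embedding (a ** b) = canonical_embedding a ** canonical_embedding b.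
Proof. by apply: dualP. Qed.

Lemma submod_val_bounded (V : normedModType R[i]) (S : submodClosed V) :
  bounded_map (@submod_val R V S).
Proof. by split => //; exists 1 => x; rewrite mul1r. Qed.

(** For a dual algebra with predual S, restricting a functional on the dual of A to S
    gives an element of A.  This map is multiplicative because S is a submodule:
    for f in S and n in the bidual, n . f is the element (pi n) . f of S again. *)
Lemma predual_projection A : dual_banach_algebra A ->
  exists pi : bidual A -> A, [/\ bounded_map pi,
    forall m n, pi (m ** n) = pi m ** pi n &
    forall a, pi (canonical_embedding a) = a].
Proof.
move=> [S [_ Smod Siso Sonto]].
have inj a b : (forall f, f \in S -> f a = f b) -> a = b.
  move=> ab; apply/eqP; rewrite -subr_eq0 -normr_eq0 -Siso normr_eq0; apply/eqP.
  by apply: dualP => f; rewrite /= linearB/= (ab _ (submod_prop f)) subrr.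
have [pi piE] := choice (fun m : bidual A => Sonto (dual_map (submod_val_bounded S) m)).
have piS m f : f \in S -> f (pi m) = m f.
  by move=> fS; have /(congr1 (fun g : dual _ => g (SubmodOf fS))) := piE m.
exists pi; split.
- split.
    move=> c m n; apply: inj => f fS.
    by rewrite linearP/= !piS.
  exists 1 => m; rewrite mul1r -lecR -!rnormE -Siso piE !rnormE lecR.
  by apply: dual_norm_le => [|f]; [exact: rnorm_ge0|exact: (dual_norm_bound m (submod_val f))].
- move=> m n; apply: inj => f fS; rewrite piS//.
  have nf : bidual_act n f = dual_lact (pi n) f.
    by apply: dualP => a /=; rewrite -piS//; exact: (Smod a f fS).2.
  rewrite -[LHS]/(m (bidual_act n f)) nf -piS//.
  exact: (Smod (pi n) f fS).1.
- by move=> a; apply: inj => f fS; rewrite piS.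
Qed.

Lemma approx_dual_algebra A : dual_banach_algebra A ->
  approx_weakly_amenable (bidual A) -> approx_weakly_amenable A.
Proof.
move=> /predual_projection[pi [pib piM piK]].
apply: approx_retract pib piM (canonical_embedding_bounded A) _ piK.
exact: canonical_embeddingM.
Qed.

End Bidual.

(** * Direct sums *)

Section DirectSum.
Context {R : realType} {A B : banachAlgType R}.

Definition l1fst (x : l1sum A B) : A := x.1.
Definition l1snd (x : l1sum A B) : B := x.2.
Definition l1inl (a : A) : l1sum A B := (a, 0).
Definition l1inr (b : B) : l1sum A B := (0, b).

Lemma l1fst_bounded : bounded_map l1fst.
Proof. by split => //; exists 1 => x; rewrite mul1r l1sum_rnormE lerDl rnorm_ge0. Qed.

Lemma l1snd_bounded : bounded_map l1snd.
Proof. by split => //; exists 1 => x; rewrite mul1r l1sum_rnormE lerDr rnorm_ge0. Qed.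

Lemma l1inl_bounded : bounded_map l1inl.
Proof.
split; first by move=> c x y; apply: injective_projections; rewrite /= ?scaler0 ?addr0.
by exists 1 => x; rewrite mul1r l1sum_rnormE rnorm0 addr0.
Qed.

Lemma l1inr_bounded : bounded_map l1inr.
Proof.
split; first by move=> c x y; apply: injective_projections; rewrite /= ?scaler0 ?addr0.
by exists 1 => x; rewrite mul1r l1sum_rnormE rnorm0 add0r.
Qed.

Lemma l1inlM a b : l1inl (a ** b) = l1inl a ** l1inl b.
Proof. by apply: injective_projections; rewrite /= ?bmul0l. Qed.

Lemma l1inrM a b : l1inr (a ** b) = l1inr a ** l1inr b.
Proof. by apply: injective_projections; rewrite /= ?bmul0l. Qed.

Lemma l1inlr a b : l1inl a ** l1inr b = 0.
Proof. by apply: injective_projections; rewrite /= ?bmul0l ?bmul0r. Qed.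

Lemma l1inrl a b : l1inr b ** l1inl a = 0.
Proof. by apply: injective_projections; rewrite /= ?bmul0l ?bmul0r. Qed.

Lemma l1sumE x : x = l1inl (l1fst x) + l1inr (l1snd x).
Proof. by case: x => a b; apply: injective_projections; rewrite /= ?addr0 ?add0r. Qed.

Lemma approx_l1sum_components : approx_weakly_amenable (l1sum A B) ->
  approx_weakly_amenable A /\ approx_weakly_amenable B.
Proof.
move=> wAB; split.
  by apply: approx_retract l1fst_bounded _ l1inl_bounded l1inlM _ wAB.
by apply: approx_retract l1snd_bounded _ l1inr_bounded l1inrM _ wAB.
Qed.

(** The mixed values D (a, 0) (0, b) vanish, since as functionals of a they kill
    the products and A is essential; likewise for D (0, b) (a, 0).  So D is the sum
    of a derivation of A and a derivation of B, which are approximated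
    independently: hence the product of the two directed sets. *)
Lemma approx_l1sum : approx_weakly_amenable A -> approx_weakly_amenable B ->
  approx_weakly_amenable (l1sum A B).
Proof.
move=> wA wB; have [eA eB] := (approx_essential wA, approx_essential wB).
move/approx_weakly_amenableP : wA => wA; move/approx_weakly_amenableP : wB => wB.
apply/approx_weakly_amenableP => D dD; have [Db Dm] := dD.
have Dab a b : D (l1inl a) (l1inr b) = 0.
  apply: (eA (fun a => D (l1inl a) (l1inr b))).
    exact: bounded_map_comp (bounded_map_eval _) (bounded_map_comp Db l1inl_bounded).
  by move=> a1 a2; rewrite l1inlM Dm l1inlr l1inrl !linear0 addr0.
have Dba a b : D (l1inr b) (l1inl a) = 0.
  apply: (eB (fun b => D (l1inr b) (l1inl a))).
    exact: bounded_map_comp (bounded_map_eval _) (bounded_map_comp Db l1inr_bounded).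
  by move=> b1 b2; rewrite l1inrM Dm l1inlr l1inrl !linear0 addr0.
have /wA/is_approx_innerP[I [leI [x [dI xD]]]] := derivation_restrict l1inl_bounded l1inlM dD.
have /wB/is_approx_innerP[J [leJ [y [dJ yD]]]] := derivation_restrict l1inr_bounded l1inrM dD.
have [[i0] reflI transI ubI] := dI; have [[j0] reflJ transJ ubJ] := dJ.
apply/is_approx_innerP.
exists (I * J)%type, (fun p q => leI p.1 q.1 /\ leJ p.2 q.2),
  (fun p => dual_map l1fst_bounded (x p.1) + dual_map l1snd_bounded (y p.2)); split.
  split; first by constructor; exact: (i0, j0).
  - by move=> [i j].
  - by move=> p q r [pq1 pq2] [qr1 qr2]; split; [exact: transI qr1|exact: transJ qr2].
  - move=> [i j] [i' j'] /=; have [k [ik i'k]] := ubI i i'; have [l [jl j'l]] := ubJ j j'.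
    by exists (k, l).
move=> a e e0; have [i ix] := xD (l1fst a) e e0; have [j jy] := yD (l1snd a) e e0.
exists (i, j) => p [/ix xe /jy ye] c.
rewrite !dualDE.
have -> : D a c = D (l1inl (l1fst a)) (l1inl (l1fst c)) + D (l1inr (l1snd a)) (l1inr (l1snd c)).
  rewrite {1}(l1sumE a) {1}(l1sumE c) -[l1inl (l1fst a)]scale1r Db.1 !scale1r.
  by rewrite dualDE !linearD/= Dab Dba addr0 add0r.
have := xe (l1fst c); have := ye (l1snd c); rewrite l1sum_rnormE /= => le2 le1.
rewrite mulrDr; apply: le_trans (lerD le1 le2).
apply: le_trans (rnormD _ _).
by rewrite /= !opprD (addrACA (x _ _)) [X in rnorm X <= _]addrACA.
Qed.

End DirectSum.

(** * Functionals on the projective tensor product *)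

Section Extension.
Context {R : realType}.

(** The value l of the extension at w is characterised by |L v - l| <= M |j v - w|
    for all v; this determines l since j has dense range, and all the properties of
    the extension follow from uniqueness. *)
Lemma extension_by_density (V : lmodType R[i]) (W : normedModType R[i])
    (j : V -> W) (L : V -> R[i]^o) (M : R) :
  linear j -> linear L -> 0 <= M ->
  (forall v, rnorm (L v) <= M * rnorm (j v)) ->
  (forall w (e : R), 0 < e -> exists v, rnorm (w - j v) <= e) ->
  exists f : dual W, (forall v, f (j v) = L v) /\
    forall w, rnorm (f w) <= M * rnorm w.
Proof.
move=> jl Ll M0 LM dense.
have jB u v : j (u - v) = j u - j v by rewrite -scaleN1r addrC jl scaleN1r addrC.
have LB u v : L (u - v) = L u - L v by rewrite -scaleN1r addrC Ll scaleN1r addrC.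
pose ext w (l : R[i]^o) := forall v, rnorm (L v - l) <= M * rnorm (j v - w).
have ext_ex w : exists l, ext w l.
  have inv_gt0 n : 0 < n.+1%:R^-1 :> R by rewrite invr_gt0.
  (* l is the limit of L along a sequence whose image converges to w *)
  have [u uw] := choice (fun n => dense w _ (inv_gt0 n)).
  have small (e : R) : 0 < e -> exists N, forall n, (N <= n)%N -> rnorm (w - j (u n)) < e.
    move=> e0; exists (Num.truncn e^-1) => n Nn; apply: le_lt_trans (uw n) _.
    rewrite invf_plt ?posrE//; apply: lt_le_trans (truncnS_gt _) _.
    by rewrite ler_nat.
  have M1 : 0 < M + 1 by rewrite ltr_wpDl.
  have [l ul] : exists l, rlimit (L \o u) l.
    apply: complex_seq_complete => e e0.
    have [N Ne] := small _ (divr_gt0 (divr_gt0 e0 M1) (@ltr0Sn R 1)).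
    exists N => m n Nm Nn; rewrite /= -LB (le_lt_trans (LM _))// jB.
    have -> : j (u m) - j (u n) = (j (u m) - w) + (w - j (u n)) by rewrite addrA subrK.
    apply: (@le_lt_trans _ _ ((M + 1) * rnorm (j (u m) - w + (w - j (u n))))).
      by rewrite ler_wpM2r ?rnorm_ge0// lerDl.
    rewrite mulrC -ltr_pdivlMr// (le_lt_trans (rnormD _ _))// [ltRHS]splitr.
    by rewrite ltrD// ?Ne// rdistC Ne.
  exists l => v; apply/ler_addgt0Pr => e e0; have e2 : 0 < e / 2 by rewrite divr_gt0.
  have [N Ne] := small _ (divr_gt0 e2 M1); have [N' Ne'] := ul _ e2.
  set n := maxn N N'.
  have := Ne n (leq_maxl _ _); have := Ne' n (leq_maxr _ _) => /= /ltW le1.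
  rewrite ltr_pdivlMr// => /ltW le2.
  have -> : L v - l = L (v - u n) + (L (u n) - l) by rewrite LB addrA subrK.
  rewrite (le_trans (rnormD _ _))// (splitr e) addrA lerD//.
  rewrite (le_trans (LM _))// jB.
  have -> : j v - j (u n) = (j v - w) + (w - j (u n)) by rewrite addrA subrK.
  apply: (@le_trans _ _ (M * (rnorm (j v - w) + rnorm (w - j (u n))))).
    by rewrite ler_wpM2l// rnormD.
  rewrite mulrDr lerD2l (le_trans _ le2)// mulrC ler_wpM2l ?rnorm_ge0//.
  by rewrite lerDl.
have ext_uniq w l l' : ext w l -> ext w l' -> l = l'.
  move=> wl wl'; apply/eqP; rewrite -subr_eq0; apply/eqP.
  apply: (@rnorm_eps0 _ _ (M + M)) => e /(dense w)[v vw].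
  have -> : l - l' = (L v - l') - (L v - l) by rewrite opprB [RHS]addrC addrA subrK.
  rewrite (le_trans (rnormD _ _))// rnormN mulrDr lerD//.
    by rewrite (le_trans (wl' v))// mulrC ler_wpM2r// rdistC.
  by rewrite (le_trans (wl v))// mulrC ler_wpM2r// rdistC.
have [f fE] := choice ext_ex.
have fl : linear f.
  move=> c x y; apply: ext_uniq (fE _) _ => v; apply/ler_addgt0Pr => e e0.
  (* approximating x and y within d costs 2 M (|c| + 1) d, to be at most e *)
  have c1 : 0 < (M + M) * (rnorm (c : R[i]^o) + 1) + 1.
    by rewrite ltr_wpDl// mulr_ge0 ?addr_ge0// rnorm_ge0.
  have e1 := divr_gt0 e0 c1; set d := e / _ in e1.
  have [p px] := dense x _ e1; have [q qy] := dense y _ e1.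
  have := fE x p; have := fE y q => le1 le2.
  have -> : L v - (c *: f x + f y) =
    L (v - (c *: p + q)) + (c *: (L p - f x) + (L q - f y)).
    by rewrite LB Ll scalerBr [X in _ = _ + X]addrACA -opprD addrA subrK.
  have jE : j (v - (c *: p + q)) = (j v - (c *: x + y)) + (c *: (x - j p) + (y - j q)).
    by rewrite jB jl scalerBr [X in _ = _ + X]addrACA -opprD addrA subrK.
  rewrite (le_trans (rnormD _ _))//.
  set r := rnorm (c : R[i]^o) in c1 d e1 px qy *.
  have r0 : 0 <= r by exact: rnorm_ge0.
  have h1 : rnorm (L (v - (c *: p + q))) <= M * (rnorm (j v - (c *: x + y)) + (r * d + d)).
    rewrite (le_trans (LM _))// jE ler_wpM2l// (le_trans (rnormD _ _))// lerD2l.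
    by rewrite (le_trans (rnormD _ _))// lerD// rnormZ ler_wpM2l.
  have h2 : rnorm (c *: (L p - f x) + (L q - f y)) <= r * (M * d) + M * d.
    rewrite (le_trans (rnormD _ _))// lerD//.
      by rewrite rnormZ ler_wpM2l// (le_trans le2)// ler_wpM2l// rdistC.
    by rewrite (le_trans le1)// ler_wpM2l// rdistC.
  apply: le_trans (lerD h1 h2) _.
  have de : d * ((M + M) * (r + 1) + 1) = e by rewrite divfK// gt_eqF.
  rewrite -de; lra.
have fM w : rnorm (f w) <= M * rnorm w.
  have := fE w 0; have := LB 0 0; have := jB 0 0; rewrite !subrr => -> ->.
  by rewrite !sub0r !rnormN.
exists (dual_of (conj fl (ex_intro _ M fM))); split=> // v /=.
apply: ext_uniq (fE _) _ => u.
by rewrite -LB -jB.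
Qed.

End Extension.

Section TensorForms.
Context {R : realType}.
Implicit Types A B : banachAlgType R.

Definition bounded_bilinear (U V W : normedModType R[i]) (f : U -> V -> W) (M : R) : Prop :=
  [/\ forall v, linear (f^~ v), forall u, linear (f u) &
      forall u v, rnorm (f u v) <= M * rnorm u * rnorm v].

Lemma ptensor_linearl A B (b : B) : linear (fun a : A => ptensor a b).
Proof.
by move=> c x y; rewrite /ptensor pure_tensorDl pure_tensorZl completion_of_linear.
Qed.

Lemma ptensor_linearr A B (a : A) : linear (fun b : B => ptensor a b).
Proof.
by move=> c x y; rewrite /ptensor pure_tensorDr pure_tensorZr completion_of_linear.
Qed.

Lemma ptensor_rnorm A B (a : A) (b : B) : rnorm (ptensor a b) <= rnorm a * rnorm b.
Proof.
have := ptensor_norm [:: (a, b)]; rewrite !big_seq1 /= => ->.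
by have := proj_norm_le [:: (a, b)]; rewrite /cross_sum !big_seq1.
Qed.

Lemma ptensor_ext0 A B (V : normedModType R[i]) (f : proj_tensor A B -> V) :
  bounded_map f -> (forall a b, f (ptensor a b) = 0) -> forall x, f x = 0.
Proof.
move=> fb f0 x; have [fl _] := fb; have [M M0 fM] := bounded_map_bound fb.
apply: (@rnorm_eps0 _ _ M) => e /(ptensor_dense x)[s sx].
have fs : f (\sum_(q <- s) ptensor q.1 q.2) = 0.
  have -> : f (\sum_(q <- s) ptensor q.1 q.2) = \sum_(q <- s) f (ptensor q.1 q.2).
    exact: (linear_sum (linear_of fl)).
  by rewrite big1.
have -> : f x = f (x - \sum_(q <- s) ptensor q.1 q.2).
  by rewrite -[f (_ - _)]/(linear_of fl _) linearB /= [X in _ - X]fs subr0.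
by rewrite (le_trans (fM _))// mulrC ler_wpM2r// ltW.
Qed.

(** The universal property of the projective tensor product, for scalar targets.  The
    bound by the projective norm holds because it holds for every representation of
    a tensor as a sum of elementary ones. *)
Lemma bilinear_lift A B (T : A -> B -> R[i]^o) (M : R) : 0 <= M ->
  bounded_bilinear T M ->
  exists f : dual (proj_tensor A B), (forall a b, f (ptensor a b) = T a b) /\
    forall x, rnorm (f x) <= M * rnorm x.
Proof.
move=> M0 [Tl Tr TM].
pose Phi := BilinearForm Tl Tr.
have [] := @extension_by_density _ _ (proj_tensor A B)
  (@completion_of _ (tensor_algebra A B)) (fun u : alg_tensor A B => u Phi) M.
- exact: completion_of_linear.
- by [].
- by [].
- move=> u; rewrite (completion_of_norm (S := tensor_algebra A B)) /=.
  apply/ler_addgt0Pr => e e0; have M1 : 0 < M + 1 by rewrite ltr_wpDl.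
  have [s us lts] := proj_norm_adherent u (divr_gt0 e0 M1).
  apply: (@le_trans _ _ (M * cross_sum s)).
    rewrite us sum_pure_tensorE /tensor_sum /cross_sum mulr_sumr.
    elim/big_ind2 : _ => [|x y z t xy zt|p _]; first by rewrite rnorm0.
      by rewrite (le_trans (rnormD _ _))// lerD.
    by rewrite mulrA; exact: TM.
  rewrite (le_trans (ler_wpM2l M0 (ltW lts)))// mulrDr lerD2l mulrCA.
  by rewrite ger_pMr// ler_pdivrMr// mul1r lerDl.
- exact: completion_of_dense.
by move=> f [fE fM]; exists f; split=> // a b; rewrite -[RHS]/(pure_tensor a b Phi) -fE.
Qed.

End TensorForms.

(** * Derivations of a projective tensor product as 4-linear forms *)

Section TensorDerivations.
Context {R : realType}.
Implicit Types A B : banachAlgType R.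

(** The forms T a b c d = D (a (x) b) (c (x) d) for a derivation D.  Such a form
    determines D, as elementary tensors span a dense subspace, and turns questions
    about derivations of the completion into computations in A and B. *)
Definition tensor_derivation A B (T : A -> B -> A -> B -> R[i]^o) : Prop :=
  [/\ (forall b c d, linear (fun a => T a b c d)) /\
      (forall a c d, linear (fun b => T a b c d)),
      (forall a b d, linear (fun c => T a b c d)) /\
      (forall a b c, linear (fun d => T a b c d)),
      exists2 M : R, 0 <= M & forall a b c d,
        rnorm (T a b c d) <= M * rnorm a * rnorm b * (rnorm c * rnorm d) &
      forall a b a' b' c d, T (a ** a') (b ** b') c d =
        T a b (a' ** c) (b' ** d) + T a' b' (c ** a) (d ** b)].

Lemma derivation_tensor A B (D : proj_tensor A B -> dual (proj_tensor A B)) :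
  derivation D ->
  tensor_derivation (fun a b c d => D (ptensor a b) (ptensor c d)).
Proof.
move=> [Db Dm]; have [Dl _] := Db; split.
- split=> [b c d k x y|a c d k x y].
    by rewrite ptensor_linearl Dl.
  by rewrite ptensor_linearr Dl.
- split=> [a b d k x y|a b c k x y].
    by rewrite ptensor_linearl linearP.
  by rewrite ptensor_linearr linearP.
- have [M M0 DM] := bounded_map_bound Db; exists M; first exact: ltW.
  move=> a b c d; rewrite (le_trans (dual_norm_bound _ _))//.
  rewrite ler_pM ?rnorm_ge0 ?dual_norm_ge0 ?ptensor_rnorm//.
  by rewrite (le_trans (DM _))// -mulrA ler_wpM2l ?(ltW M0)// ptensor_rnorm.
- by move=> a b a' b' c d; rewrite -ptensorM Dm !ptensorM.
Qed.

Lemma dual_ptensor_ext A B (f g : dual (proj_tensor A B)) :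
  (forall a b, f (ptensor a b) = g (ptensor a b)) -> f = g.
Proof.
move=> fg; apply: dualP => x; apply/eqP; rewrite -subr_eq0; apply/eqP.
apply: (ptensor_ext0 (bounded_mapB (bounded_map_dual f) (bounded_map_dual g))).
by move=> a b; rewrite fg subrr.
Qed.

(** The pair (c, d) is extended to the completion first, then the pair (a, b).  The
    derivation identity is trilinear and bounded, so it is enough to check it on
    elementary tensors. *)
Lemma tensor_derivation_lift A B (T : A -> B -> A -> B -> R[i]^o) :
  tensor_derivation T ->
  exists2 E : proj_tensor A B -> dual (proj_tensor A B), derivation E &
    forall a b c d, E (ptensor a b) (ptensor c d) = T a b c d.
Proof.
move=> [[T1 T2] [T3 T4] [M M0 TM] Tm].
have M3 (a : A) (b : B) : 0 <= M * rnorm a * rnorm b by rewrite !mulr_ge0 ?rnorm_ge0.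
have /choice[e eE] : forall p : A * B, exists f : dual (proj_tensor A B),
    (forall c d, f (ptensor c d) = T p.1 p.2 c d) /\
    forall x, rnorm (f x) <= M * rnorm p.1 * rnorm p.2 * rnorm x.
  move=> [a b] /=; apply: bilinear_lift => //.
  by split=> // c d; rewrite -mulrA; exact: TM.
have /choice[g gE] : forall y, exists f : dual (proj_tensor A B),
    (forall a b, f (ptensor a b) = e (a, b) y) /\
    forall x, rnorm (f x) <= M * rnorm y * rnorm x.
  move=> y.
  apply: (@bilinear_lift _ _ _ (fun a b => e (a, b) y) (M * rnorm y)).
    by rewrite mulr_ge0 ?rnorm_ge0.
  split=> [b k a a'|a k b b'|a b].
  - rewrite -dualZE -dualDE; congr (dual_fun _ y); apply: dual_ptensor_ext => c d.
    by rewrite dualDE dualZE !(eE _).1 /= T1.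
  - rewrite -dualZE -dualDE; congr (dual_fun _ y); apply: dual_ptensor_ext => c d.
    by rewrite dualDE dualZE !(eE _).1 /= T2.
  - rewrite (le_trans ((eE _).2 y))//= -!mulrA ler_wpM2l//.
    by rewrite [leRHS]mulrC mulrA.
have gb x : bounded_map (fun y => g y x).
  split; last by exists (M * rnorm x) => y; rewrite mulrAC; exact: (gE y).2.
  move=> k y y'; rewrite -dualZE -dualDE; congr (dual_fun _ x).
  by apply: dual_ptensor_ext => a b; rewrite dualDE dualZE !(gE _).1 linearP.
pose E x := dual_of (gb x).
have Eb : bounded_map E.
  split; first by move=> k x x'; apply: dualP => y; rewrite /= linearP.
  exists M => x; apply: dual_norm_le => [|y]; first by rewrite mulr_ge0 ?rnorm_ge0.
  by rewrite mulrAC; exact: (gE y).2.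
have ET a b c d : E (ptensor a b) (ptensor c d) = T a b c d.
  by rewrite /= (gE _).1 (eE _).1.
exists E => //; split=> //.
(* F is the defect of the derivation identity *)
pose F x y z := E (x ** y) z - E x (y ** z) - E y (z ** x).
suff F0 x y z : F x y z = 0.
  move=> x y z; apply/eqP; rewrite -subr_eq0 opprD addrA; apply/eqP.
  exact: F0.
have Fx y' z' : bounded_map (fun x => F x y' z').
  apply: bounded_mapB; first apply: bounded_mapB.
  - exact: bounded_map_comp (bounded_map_eval z') (bounded_map_comp Eb (bounded_mulr y')).
  - exact: bounded_map_comp (bounded_map_eval _) Eb.
  - exact: bounded_map_comp (bounded_map_dual _) (bounded_mull z').
have Fy x' z' : bounded_map (fun y => F x' y z').
  apply: bounded_mapB; first apply: bounded_mapB.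
  - exact: bounded_map_comp (bounded_map_eval z') (bounded_map_comp Eb (bounded_mull x')).
  - exact: bounded_map_comp (bounded_map_dual _) (bounded_mulr z').
  - exact: bounded_map_comp (bounded_map_eval _) Eb.
have Fz x' y' : bounded_map (F x' y').
  apply: bounded_mapB; first apply: bounded_mapB.
  - exact: bounded_map_dual.
  - exact: bounded_map_comp (bounded_map_dual _) (bounded_mull y').
  - exact: bounded_map_comp (bounded_map_dual _) (bounded_mulr x').
apply: (ptensor_ext0 (Fx y z)) => a b; apply: (ptensor_ext0 (Fy _ z)) => a' b'.
apply: (ptensor_ext0 (Fz _ _)) => c d.
by rewrite /F !ptensorM !ET Tm addrAC addrK subrr.
Qed.

Lemma zero_tensor_derivations A B :
  (forall T : A -> B -> A -> B -> R[i]^o, tensor_derivation T ->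
     forall a b c d, T a b c d = 0) ->
  zero_derivations (proj_tensor A B).
Proof.
move=> T0 D dD; have [Db _] := dD; have DT := T0 _ (derivation_tensor dD).
move=> x y; apply: (ptensor_ext0 (bounded_map_comp (bounded_map_eval y) Db)) => a b.
by apply: (ptensor_ext0 (bounded_map_dual _)) => c d; exact: DT.
Qed.

End TensorDerivations.

(** * Tensor products of commutative algebras *)

Section CommutativeTensor.
Context {R : realType}.
Implicit Types A B : banachAlgType R.

Section Slots.
Context {A B : banachAlgType R} {T : A -> B -> A -> B -> R[i]^o}.
Context (dT : tensor_derivation T).

Lemma tensor_slot1 b c d : bounded_map (fun a => T a b c d).
Proof.
have [[T1 _] _ [M M0 TM] _] := dT; split=> //.
exists (M * rnorm b * (rnorm c * rnorm d)) => a; apply: le_trans (TM a b c d) _.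
lra.
Qed.

Lemma tensor_slot2 a c d : bounded_map (fun b => T a b c d).
Proof.
have [[_ T2] _ [M M0 TM] _] := dT; split=> //.
exists (M * rnorm a * (rnorm c * rnorm d)) => b; apply: le_trans (TM a b c d) _.
lra.
Qed.

Lemma tensor_slot3 a b d : bounded_map (fun c => T a b c d).
Proof.
have [_ [T3 _] [M M0 TM] _] := dT; split=> //.
exists (M * rnorm a * rnorm b * rnorm d) => c; apply: le_trans (TM a b c d) _.
lra.
Qed.

Lemma tensor_slot4 a b c : bounded_map (fun d => T a b c d).
Proof.
have [_ [_ T4] [M M0 TM] _] := dT; split=> //.
exists (M * rnorm a * rnorm b * rnorm c) => d; apply: le_trans (TM a b c d) _.
lra.
Qed.

Lemma tensor_derivation_swap :
  tensor_derivation (fun b a d c => T a b c d).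
Proof.
have [[T1 T2] [T3 T4] [M M0 TM] Tm] := dT; split=> //; exists M => // b a d c.
apply: le_trans (TM a b c d) _.
lra.
Qed.

End Slots.

(** S a p q w y is the difference of the two sides.  Formally it is the value of
    D (a (x) 1) at (pw) (x) (qy), for the derivation D encoded by T, although the
    multiplier a (x) 1 need not belong to the algebra.  The identity for T
    shows that a factor in the slot p can be moved to the slot w, at first when p and
    q are products, then always because A and B are essential.  Hence
    a |-> (a' |-> S a p q (a' w) y) is a derivation of A, so it is zero, and
    S vanishes because A is essential. *)
Lemma tensor_derivation_shift A B (T : A -> B -> A -> B -> R[i]^o) :
  commutative_algebra A -> zero_derivations A -> essential B ->
  tensor_derivation T ->
  forall a p q w y, T (a ** p) q w y = T p q (a ** w) y.
Proof.
move=> cA zA eB dT; have eA := zero_derivations_essential zA.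
have [_ _ [M M0 TM] Tm] := dT.
have AC (a b c : A) : a ** (b ** c) = b ** (a ** c) by rewrite !bmulA (cA a).
pose S a p q w y := T (a ** p) q w y - T p q (a ** w) y.
have Sp a q w y : bounded_map (fun p => S a p q w y).
  apply: bounded_mapB (tensor_slot1 dT _ _ _).
  exact: bounded_map_comp (tensor_slot1 dT _ _ _) (bounded_mull a).
have Sq a p w y : bounded_map (fun q => S a p q w y).
  exact: bounded_mapB (tensor_slot2 dT _ _ _) (tensor_slot2 dT _ _ _).
have Sw a p q y : bounded_map (fun w => S a p q w y).
  apply: bounded_mapB (tensor_slot3 dT _ _ _) _.
  exact: bounded_map_comp (tensor_slot3 dT _ _ _) (bounded_mull a).
have Sa p q w y : bounded_map (fun a => S a p q w y).
  apply: bounded_mapB.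
    exact: bounded_map_comp (tensor_slot1 dT _ _ _) (bounded_mulr p).
  exact: bounded_map_comp (tensor_slot3 dT _ _ _) (bounded_mulr w).
have S_prod a p p' q q' w y :
    S a (p ** p') (q ** q') w y = S a p q (p' ** w) (q' ** y).
  have E : w ** (a ** p) = (a ** w) ** p by rewrite AC bmulA.
  by rewrite /S bmulA !Tm E (AC p' a w) opprD addrACA subrr addr0.
have S_sym a c p q w y : S a (c ** p) q w y = S a p q (c ** w) y.
  apply/eqP; rewrite -subr_eq0; apply/eqP.
  apply: (eA (fun p => S a (c ** p) q w y - S a p q (c ** w) y)).
    apply: bounded_mapB (Sp _ _ _ _).
    exact: bounded_map_comp (Sp _ _ _ _) (bounded_mull c).
  move=> p1 p2.
  apply: (eB (fun q => S a (c ** (p1 ** p2)) q w y - S a (p1 ** p2) q (c ** w) y)).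
    exact: bounded_mapB (Sq _ _ _ _) (Sq _ _ _ _).
  by move=> q1 q2; rewrite AC !S_prod -bmulA AC subrr.
have S_mul a a' p q w y :
    S (a ** a') p q w y = S a (a' ** p) q w y + S a' p q (a ** w) y.
  by rewrite /S -!bmulA (AC a' a) addrA subrK.
pose G p q w y a := dual_of (bounded_map_comp (Sw a p q y) (bounded_mulr w)).
have dG p q w y : derivation (G p q w y).
  split; last first.
    move=> a a' a''; rewrite /= S_mul S_sym -!bmulA; congr (_ + S a' p q _ y).
    exact: AC.
  split.
    by move=> k a a'; apply: dualP => x; rewrite /= (Sa _ _ _ _).1.
  exists ((M + M) * rnorm p * rnorm q * rnorm w * rnorm y) => a.
  apply: dual_norm_le => [|x]; first by rewrite !mulr_ge0 ?addr_ge0 ?rnorm_ge0.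
  rewrite /= /S (le_trans (rnormD _ _))// rnormN.
  have h1 : rnorm (T (a ** p) q (x ** w) y) <=
      M * (rnorm a * rnorm p) * rnorm q * (rnorm x * rnorm w * rnorm y).
    apply: le_trans (TM _ _ _ _) _.
    rewrite ler_pM ?mulr_ge0 ?rnorm_ge0//; last by rewrite ler_wpM2r ?rnorm_ge0 ?rnormM.
    by rewrite ler_wpM2r ?rnorm_ge0// ler_wpM2l// rnormM.
  have h2 : rnorm (T p q (a ** (x ** w)) y) <=
      M * rnorm p * rnorm q * (rnorm a * (rnorm x * rnorm w) * rnorm y).
    apply: le_trans (TM _ _ _ _) _.
    rewrite ler_wpM2l ?mulr_ge0 ?rnorm_ge0// ler_wpM2r ?rnorm_ge0//.
    by rewrite (le_trans (rnormM _ _))// ler_wpM2l ?rnorm_ge0 ?rnormM.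
  apply: le_trans (lerD h1 h2) _.
  lra.
move=> a p q w y; apply/eqP; rewrite -subr_eq0; apply/eqP.
apply: (eA _ (Sw a p q y)) => x w'.
by have := zA _ (dG p q w' y) a x.
Qed.

(** By the shift lemma in both factors, T (aa') (bb') c d = T a' b' (ac) (bd).  The
    derivation identity has the extra term T a b (a'c) (b'd), which is therefore
    zero; as A and B are essential, T = 0. *)
Lemma commutative_tensor_zero_derivations A B :
  commutative_algebra A -> commutative_algebra B ->
  zero_derivations A -> zero_derivations B ->
  zero_derivations (proj_tensor A B).
Proof.
move=> cA cB zA zB.
have [eA eB] := (zero_derivations_essential zA, zero_derivations_essential zB).
apply: zero_tensor_derivations => T dT a b.
have [_ _ _ Tm] := dT.
have Tprod a' b' c d : T a b (a' ** c) (b' ** d) = 0.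
  apply: (addIr (T a' b' (c ** a) (d ** b))); rewrite -Tm add0r.
  rewrite (tensor_derivation_shift cA zA eB dT).
  rewrite (tensor_derivation_shift cB zB eA (tensor_derivation_swap dT)).
  by rewrite cA cB.
move=> c d; apply: (eA _ (tensor_slot3 dT a b d)) => a' c'.
by apply: (eB _ (tensor_slot4 dT a b _)) => b' d'; exact: Tprod.
Qed.

Lemma proj_tensor_commutative A B :
  commutative_algebra A -> commutative_algebra B ->
  commutative_algebra (proj_tensor A B).
Proof.
move=> cA cB x y; apply/eqP; rewrite -subr_eq0; apply/eqP.
apply: (ptensor_ext0 (bounded_mapB (bounded_mulr y) (bounded_mull y))) => a b.
apply: (ptensor_ext0 (bounded_mapB (bounded_mull _) (bounded_mulr _))) => c d.
by rewrite !ptensorM cA cB subrr.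
Qed.

Lemma rnorm_scalarM (x y : R[i]^o) : rnorm (x * y : R[i]^o) = rnorm x * rnorm y.
Proof. exact: rnormZ. Qed.

Lemma scalar_bounded_bound (V : normedModType R[i]) (f : V -> R[i]^o) :
  bounded_map f -> exists2 M : R, 0 <= M & forall x, rnorm (f x) <= M * rnorm x.
Proof. by move=> /bounded_map_bound[M /ltW M0 fM]; exists M. Qed.

Lemma tensor_derivation_functional A (f : A -> R[i]^o) :
  bounded_map f -> (forall a b, f (a ** b) = 0) ->
  tensor_derivation (fun a b c d => f a * f b * (f c * f d) : R[i]^o).
Proof.
move=> fb f0; have [fl _] := fb; have [M M0 fM] := scalar_bounded_bound fb.
have sE (k x : R[i]) : k *: (x : R[i]^o) = k * x by [].
split.
- by split=> ? ? ? k x y; rewrite fl !sE; ring.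
- by split=> ? ? ? k x y; rewrite fl !sE; ring.
- exists (M * M * M * M); first by rewrite !mulr_ge0.
  move=> a b c d; rewrite !rnorm_scalarM.
  have h1 : rnorm (f a) * rnorm (f b) <= (M * rnorm a) * (M * rnorm b).
    by rewrite ler_pM ?rnorm_ge0.
  have h2 : rnorm (f c) * rnorm (f d) <= (M * rnorm c) * (M * rnorm d).
    by rewrite ler_pM ?rnorm_ge0.
  apply: le_trans (ler_pM _ _ h1 h2) _; rewrite ?mulr_ge0 ?rnorm_ge0//.
  lra.
- by move=> *; rewrite !f0 !mul0r !mulr0 addr0.
Qed.

Lemma tensor_derivation_mul A (D : A -> dual A) :
  commutative_algebra A -> derivation D ->
  tensor_derivation (fun a b c d => D (a ** b) (c ** d)).
Proof.
move=> cA [Db Dm]; have [Dl _] := Db; have [M M0 DM] := bounded_map_bound Db.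
split.
- by split=> ? ? ? k x y; rewrite ?bmulDl ?bmulDr ?bmulZl ?bmulZr Dl.
- by split=> ? ? ? k x y; rewrite ?bmulDl ?bmulDr ?bmulZl ?bmulZr linearP.
- exists M => [|a b c d]; first exact: ltW.
  rewrite (le_trans (dual_norm_bound _ _))// ler_pM ?rnorm_ge0 ?dual_norm_ge0 ?rnormM//.
  by rewrite (le_trans (DM _))// -mulrA ler_wpM2l ?(ltW M0)// rnormM.
- have AC (x y u v : A) : x ** y ** (u ** v) = x ** u ** (y ** v).
    by rewrite -!bmulA (bmulA y) (cA y u) -bmulA.
  by move=> a b a' b' c d; rewrite AC Dm (AC a' b') (AC c d).
Qed.

(** If f kills the products of A, then f (x) f kills those of the tensor square, and
    the derivation u |-> (f (x) f)(u) (f (x) f) gives f(a) ^ 4 = 0: A is essential.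
    A derivation D of A is pulled back along a (x) b |-> ab; that the pull-back is zero
    says that D (a a') (b b') = 0, which is enough in an essential algebra. *)
Lemma zero_derivations_proj_tensor A : commutative_algebra A ->
  zero_derivations (proj_tensor A A) -> zero_derivations A.
Proof.
move=> cA zAA.
have T0 (T : A -> A -> A -> A -> R[i]^o) : tensor_derivation T ->
    forall a b c d, T a b c d = 0.
  by move=> /tensor_derivation_lift[E /zAA E0 ET] a b c d; rewrite -ET E0.
have eA : essential A.
  move=> f fb f0 a; have := T0 _ (tensor_derivation_functional fb f0) a a a a.
  by move=> /eqP; rewrite !mulf_eq0 !orbb => /eqP.
move=> D dD a b; have [Db _] := dD.
apply: (eA _ (bounded_map_comp (bounded_map_eval b) Db)) => a1 a2.
apply: (eA _ (bounded_map_dual _)) => b1 b2.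
exact: T0 (tensor_derivation_mul cA dD) _ _ _ _.
Qed.

End CommutativeTensor.

(** * Characters and unital tensor products *)

Section Unital.
Context {R : realType}.
Implicit Types A B : banachAlgType R.

Lemma rcauchy_limit (V : completeNormedModType R[i]) (u : nat -> V) :
  rcauchy u -> exists l, rlimit u l.
Proof.
move=> uc; have : cvgn u.
  apply/cauchy_cvgP/cauchy_exP => e e0.
  have eE : e = (complex.Re e)%:C by rewrite RRe_real// gtr0_real.
  move: e0; rewrite eE ltcR => /uc[N Ne]; exists (u N).
  by exists N => // n /= Nn; rewrite -ball_normE/= rnormE ltcR Ne.
move=> /cvg_ex[l /cvgrPdist_lt ul]; exists l => e e0.
have [|N _ Ne] := ul e%:C; first by rewrite ltcR.
by exists N => n /Ne; rewrite /= rnormE ltcR rdistC.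
Qed.

(** The Neumann series of b, as the limit of the iterates of c |-> b + b c, which
    contracts distances by the factor |b|. *)
Lemma quasi_inverse A (b : A) : rnorm b < 1 -> exists c, c = b + b ** c.
Proof.
set s := rnorm b => s1; have s0 : 0 <= s := rnorm_ge0 b.
have t0 : 0 < 1 - s by rewrite subr_gt0.
pose u n := iter n (fun c => b + b ** c) b.
(* the sum of the powers of s from s on, which bounds all iterates *)
pose K := s / (1 - s); have K0 : 0 <= K by rewrite divr_ge0// ltW.
have KE : s + s * K = K by rewrite /K; field; rewrite gt_eqF.
have uK n : rnorm (u n) <= K.
  elim: n => [|n IH]; first by rewrite -KE lerDl mulr_ge0.
  rewrite /u iterS -/(u n) -KE (le_trans (rnormD _ _))// lerD2l.
  by rewrite (le_trans (rnormM _ _))// ler_wpM2l.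
have uD n k : rnorm (u (n + k)%N - u n) <= s ^+ n * (K + K).
  elim: n => [|n IH].
    by rewrite expr0 mul1r (le_trans (rnormD _ _))// rnormN lerD// (uK 0).
  rewrite addSn /u !iterS -/(u n) -/(u (n + k)%N) opprD addrACA subrr add0r -bmulBr.
  by rewrite (le_trans (rnormM _ _))// exprS -mulrA ler_wpM2l.
have small (e : R) : 0 < e -> exists N, s ^+ N * (K + K) < e.
  move=> e0; have KK : 0 < K + K + 1 by rewrite ltr_wpDl// addr_ge0.
  have := @cvg_expr R s; rewrite ger0_norm// => /(_ s1)/cvgrPdist_lt/(_ _ (divr_gt0 e0 KK)).
  move=> [N _ /(_ N (leqnn N))] /=; rewrite sub0r normrN ger0_norm ?exprn_ge0//.
  rewrite ltr_pdivlMr// => lte; exists N; apply: le_lt_trans lte.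
  by rewrite ler_wpM2l ?exprn_ge0// lerDl.
have uN (e : R) : 0 < e -> exists N, forall n, (N <= n)%N -> rnorm (u n - u N) < e.
  move=> /small[N Ne]; exists N => n Nn; apply: le_lt_trans Ne.
  by rewrite -(subnKC Nn).
have [c uc] : exists c, rlimit u c.
  apply: rcauchy_limit => e e0; have e2 : 0 < e / 2 by rewrite divr_gt0.
  have [N Ne] := uN _ e2; exists N => m n Nm Nn.
  have -> : u m - u n = (u m - u N) + (u N - u n) by rewrite addrA subrK.
  by rewrite (le_lt_trans (rnormD _ _))// [ltRHS]splitr ltrD ?Ne// rdistC Ne.
exists c; apply/eqP; rewrite -subr_eq0; apply/eqP; apply: (@rnorm_eps0 _ _ 2) => e.
move=> /uc[N Ne].
have -> : c - (b + b ** c) = (c - u N.+1) + b ** (u N - c).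
  by rewrite /u iterS -/(u N) bmulBr !opprD !addrA subrK.
rewrite (le_trans (rnormD _ _))// mulr_natr mulr2n lerD//.
  by rewrite rdistC ltW// Ne.
rewrite (le_trans (rnormM _ _))// (le_trans (ler_piMl _ (ltW s1)))// ?rnorm_ge0//.
by rewrite ltW// Ne.
Qed.

(** Characters are contractions: if |a| < |phi a|, then b = a / phi a has norm less
    than 1 and phi b = 1, so that c = b + bc gives phi c = 1 + phi c. *)
Lemma character_bounded A (phi : {linear A -> R[i]^o}) :
  is_character phi -> bounded_map phi.
Proof.
move=> [phiM _]; split; first exact: linearP.
exists 1 => a; rewrite mul1r leNgt; apply/negP => lta.
have pa : (phi a : R[i]) != 0.
  apply/negP => /eqP pa; move: lta; rewrite pa rnorm0 ltNge.
  by rewrite rnorm_ge0.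
have [|c cE] := @quasi_inverse A ((phi a : R[i])^-1 *: a).
  rewrite rnormZ rnormV ltr_pdivrMl ?mulr1//.
  by apply: le_lt_trans lta; exact: rnorm_ge0.
have pb : phi ((phi a : R[i])^-1 *: a) = 1.
  by rewrite linearZ/=; exact: mulVf.
have := congr1 phi cE; rewrite linearD/= phiM pb mul1r => /eqP.
by rewrite -subr_eq subrr eq_sym oner_eq0.
Qed.

Lemma character_unit A (e : A) (phi : {linear A -> R[i]^o}) :
  is_character phi -> (forall a, e ** a = a /\ a ** e = a) -> phi e = 1.
Proof.
move=> [phiM [a /eqP pa]] eP; apply: (mulIf pa).
by rewrite -phiM (eP a).1 mul1r.
Qed.

(** The derivation D pulled back along the homomorphism a (x) b |-> phi(b) a. *)
Lemma tensor_derivation_character A B (phi : B -> R[i]^o) (D : A -> dual A) :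
  bounded_map phi -> (forall a b, phi (a ** b) = phi a * phi b) ->
  derivation D ->
  tensor_derivation (fun a b c d => phi b * phi d * D a c : R[i]^o).
Proof.
move=> phib phiM [Db Dm]; have [[phil _] [Dl _]] := (phib, Db).
have [M M0 phiB] := scalar_bounded_bound phib; have [N N0 DN] := bounded_map_bound Db.
have sE (k x : R[i]) : k *: (x : R[i]^o) = k * x by [].
split.
- split=> ? ? ? k x y; first by rewrite Dl dualDE dualZE !sE; ring.
  by rewrite phil !sE; ring.
- split=> ? ? ? k x y; first by rewrite linearP/= !sE; ring.
  by rewrite phil !sE; ring.
- exists (M * M * N); first by rewrite !mulr_ge0// ltW.
  move=> a b c d; rewrite !rnorm_scalarM.
  have h1 : rnorm (phi b) * rnorm (phi d) <= (M * rnorm b) * (M * rnorm d).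
    by rewrite ler_pM ?rnorm_ge0.
  have h2 : rnorm (D a c) <= N * rnorm a * rnorm c.
    by rewrite (le_trans (dual_norm_bound _ _))// ler_wpM2r ?rnorm_ge0//; exact: DN.
  apply: le_trans (ler_pM _ _ h1 h2) _; rewrite ?mulr_ge0 ?rnorm_ge0//.
  lra.
- by move=> a b a' b' c d; rewrite !phiM Dm; ring.
Qed.

(** The homomorphism a |-> a (x) e is a right inverse of a (x) b |-> phi(b) a. *)
Lemma approx_proj_tensor_left A B (e : B) (phi : B -> R[i]^o) :
  bounded_map phi -> (forall a b, phi (a ** b) = phi a * phi b) ->
  e ** e = e -> phi e = 1 ->
  approx_weakly_amenable (proj_tensor A B) -> approx_weakly_amenable A.
Proof.
move=> phib phiM ee phie.
apply: (@approx_pullback _ _ _ (fun a => ptensor a e)).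
- split; first exact: ptensor_linearl.
  by exists (rnorm e) => a; rewrite mulrC ptensor_rnorm.
- by move=> a b; rewrite ptensorM ee.
- move=> D /(tensor_derivation_character phib phiM)/tensor_derivation_lift[E dE ET].
  by exists E => // a b; rewrite ET phie !mul1r.
Qed.

Lemma approx_proj_tensor_right A B (e : A) (phi : A -> R[i]^o) :
  bounded_map phi -> (forall a b, phi (a ** b) = phi a * phi b) ->
  e ** e = e -> phi e = 1 ->
  approx_weakly_amenable (proj_tensor A B) -> approx_weakly_amenable B.
Proof.
move=> phib phiM ee phie.
apply: (@approx_pullback _ _ _ (fun b => ptensor e b)).
- split; first exact: ptensor_linearr.
  by exists (rnorm e) => a; rewrite ptensor_rnorm.
- by move=> a b; rewrite ptensorM ee.
- move=> D /(tensor_derivation_character phib phiM)/tensor_derivation_swap.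
  move=> /tensor_derivation_lift[E dE ET].
  by exists E => // a b; rewrite ET phie !mul1r.
Qed.

End Unital.

Theorem theorem2p3 (R : realType) (A B : banachAlgType R) :
  (* (i) *)
  (forall (phi : {linear A -> B}) (psi : {linear B -> A}),
     continuous phi -> algebra_hom phi ->
     continuous psi -> algebra_hom psi ->
     (forall b : B, phi (psi b) = b) ->
     (approx_weakly_amenable A -> approx_weakly_amenable B) /\
     (approx_weakly_amenable (bidual A) -> approx_weakly_amenable (bidual B))) /\
  (* (ii) *)
  (dual_banach_algebra A ->
     approx_weakly_amenable (bidual A) -> approx_weakly_amenable A) /\
  (* (iii) *)
  (commutative_algebra A ->
     (approx_weakly_amenable A /\ approx_weakly_amenable B <->
      approx_weakly_amenable (l1sum A B))) /\
  (* (iv) *)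
  (weakly_amenable A ->
     (approx_weakly_amenable B <-> approx_weakly_amenable (l1sum A B))) /\
  (* (v) *)
  (commutative_algebra A ->
     (approx_weakly_amenable A <-> approx_weakly_amenable (proj_tensor A A))) /\
  (* (vi) *)
  (unital_algebra A -> unital_algebra B ->
   forall (phi1 : {linear A -> R[i]^o}) (phi2 : {linear B -> R[i]^o}),
     is_character phi1 -> is_character phi2 ->
     approx_weakly_amenable (proj_tensor A B) ->
     approx_weakly_amenable A /\ approx_weakly_amenable B).
Proof.
split; [|split; [|split; [|split; [|split]]]].
- move=> phi psi /continuous_bounded_map phib phiM /continuous_bounded_map psib psiM phiK.
  by split; [exact: approx_retract phiK|exact: approx_retract_bidual phiK].
- exact: approx_dual_algebra.
- move=> _; split; last exact: approx_l1sum_components.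
  by move=> [wA wB]; exact: approx_l1sum.
- move=> /weakly_amenable_approx wA; split=> [wB|/approx_l1sum_components[]//].
  exact: approx_l1sum.
- move=> cA; split=> [/(approx_zero_derivations cA) zA|].
    exact/zero_derivations_approx/commutative_tensor_zero_derivations.
  move=> /(approx_zero_derivations (proj_tensor_commutative cA cA)).
  by move=> /(zero_derivations_proj_tensor cA)/zero_derivations_approx.
- move=> [e eP] [e' eP'] phi1 phi2 chi1 chi2 wAB; split.
    apply: (approx_proj_tensor_left (character_bounded chi2) chi2.1 (eP' e').1 _ wAB).
    exact: character_unit chi2 eP'.
  apply: (approx_proj_tensor_right (character_bounded chi1) chi1.1 (eP e).1 _ wAB).
  exact: character_unit chi1 eP.
Qed.
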